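(* Let $k\ge 1$ and let $\lambda$ be a strict partition. There is a bijection $\Phi^k_\lambda$ between the set of standard shifted $k$-ribbon tableaux of shape $\lambda$ and the set of standard fillings of the $k$-quotient $\overline{\Phi^k}(\lambda)$. It preserves diagonal values: ribbons whose heads have the same diagonal value in $\lambda$ are mapped to cells lying on one common diagonal of one common component of the $k$-quotient.
   Context: Conventions. Diagrams are drawn in French convention: a cell is a pair $(c,r)$ of integers (column $c$, row $r$), with rows numbered from bottom to top. A strict partition $\lambda=(\lambda_1>\lambda_2>\cdots>\lambda_\ell>0)$ is identified with its shifted diagram $\{(c,r):1\le r\le \ell,\ r\le c\le r+\lambda_r-1\}$; so row $r$ has $\lambda_r$ cells and starts in column $r$. The diagonal value of a cell is $\mathrm{diag}(c,r)=c-r+1$. The main diagonal consists of the cells of diagonal value $1$. For strict partitions $\mu\subseteq\lambda$, the skew-shifted diagram $\lambda\setminus\mu$ is the set difference of shifted diagrams. A subset $R\subseteq\lambda$ is removable if $\lambda\setminus R$ is again (the shifted diagram of) a strict partition. Ribbons. A single ribbon is a nonempty edge-connected skew-shifted diagram whose cells have pairwise distinct diagonal values. Its head $H(R)$ is its cell of largest diagonal value and its tail $T(R)$ is its cell of smallest diagonal value. A double ribbon in $\lambda$ is a union $R\cup S$ of two disjoint single ribbons with $|R|\ge |S|$ satisfying three conditions: $T(R)$ lies on the main diagonal of $\lambda$; $T(S)$ lies on the main diagonal of $\lambda\setminus R$; and $R\cup S$ is a skew-shifted diagram. Its head is $H(R)$. A $k$-ribbon is a single or double ribbon with $k$ cells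 in total. A $k$-core is a shifted diagram with no removable $k$-ribbon. Standard shifted $k$-ribbon tableau of shape $\lambda$. This is a chain of shifted diagrams $\lambda^{(0)}\subset\lambda^{(1)}\subset\cdots\subset\lambda^{(n)}=\lambda$ such that $\lambda^{(0)}$ is a $k$-core and each $\lambda^{(i)}\setminus\lambda^{(i-1)}$ is a removable $k$-ribbon of $\lambda^{(i)}$. The ribbon $\lambda^{(i)}\setminus\lambda^{(i-1)}$ is labelled $i$. Abacus representation. For $1\le i\le k$, let $\alpha^{(i)}$ be the strict partition whose parts are the numbers $(p-i)/k+1$, where $p$ runs over the parts of $\lambda$ with $p\equiv i \pmod k$. Combination. Let $\alpha,\beta$ be strict partitions with $a,b$ rows respectively, and let $n=\min(a,b)$. Their combination $\alpha\diamond\beta$ is the pair $(C,\mathfrak d)$ defined as follows. The cell set is $$C=\{(y-(a-n),\,x-(a-n)) : (x,y)\in\alpha,\ x>a-n\}\ \cup\ \{(x-(b-n),\,y-(b-n)) : (x,y)\in\beta,\ x>b-n\}.$$ The specialized diagonal is the line $\mathfrak d=\{(x,y): x=y\}$. In words: the $|a-b|$ leftmost columns of the taller shape are deleted, $\alpha$ is transposed, and the two are glued along their main diagonals. The set $C$ is a translate of a Young diagram, called the underlying shape. $k$-quotient. The $k$-quotient $\overline{\Phi^k}(\lambda)$ is a tuple of components defined as follows. - If $k$ is odd, it is $(\alpha^{(1)}\diamond\alpha^{(k-1)},\ \alpha^{(2)}\diamond\alpha^{(k-2)},\ \dots,\ \alpha^{((k-1)/2)}\diamond\alpha^{((k+1)/2)},\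 \alpha^{(k)})$. - If $k$ is even, it is $(\alpha^{(1)}\diamond\alpha^{(k-1)},\ \dots,\ \alpha^{(k/2-1)}\diamond\alpha^{(k/2+1)},\ \alpha^{(k/2)}\diamond\varnothing,\ \alpha^{(k)})$. The last component $\alpha^{(k)}$ is a shifted diagram; the others are folded diagrams. Standard filling of the $k$-quotient. Let $N$ be the total number of cells of all components. A standard filling places the numbers $1,\dots,N$, each exactly once, in the cells of all components simultaneously. Within each component, entries must increase from left to right along rows and from bottom to top along columns. *)

(* Defs.v *)
(* MathComp, with finmap for finite sets of cells and mathcomp-classical for
   set_bij. *)
From mathcomp Require Import all_boot all_order all_algebra.
From mathcomp Require Import finmap.
From mathcomp Require Import classical_sets functions.
Set Implicit Arguments.
Unset Strict Implicit.
Unset Printing Implicit Defensive.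
Import Order.TTheory GRing.Theory Num.Theory.

(* A cell is (column, row).  Coordinates are integers, since combinations of
   strict partitions may have cells with nonpositive coordinates. *)
Notation cell := (int * int)%type.

Definition diagv (x : cell) : int := (x.1 - x.2 + 1)%R.

(* The parts of a strict partition are listed in decreasing order. *)
Definition strict_part (s : seq nat) : bool := sorted gtn s && (0 \notin s).

(* Row r runs over the columns r, ..., r + lam_r - 1, listed by iota r lam_r. *)
Definition sdiagram (lam : seq nat) : {fset cell} :=
  [fset (Posz c, Posz r) | r in iota 1 (size lam),
                             c in iota r (nth 0 lam r.-1)]%fset.

Definition skew_shifted (X : {fset cell}) : Prop :=
  exists lam mu : seq nat,
    [/\ strict_part lam, strict_part mu,
        (sdiagram mu `<=` sdiagram lam)%fset
      & X = (sdiagram lam `\` sdiagram mu)%fset].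

Definition main_diag (X : {fset cell}) : {fset cell} :=
  [fset x in X | diagv x == 1%R]%fset.

Definition removable (lam : seq nat) (R : {fset cell}) : Prop :=
  (R `<=` sdiagram lam)%fset /\
  exists mu : seq nat,
    strict_part mu /\ (sdiagram lam `\` R)%fset = sdiagram mu.

Definition adjacent (x y : cell) : bool :=
  (`|x.1 - y.1| + `|x.2 - y.2| == 1)%R.

Definition edge_connected (X : {fset cell}) : Prop :=
  forall x y : X, connect (fun u v : X => adjacent (val u) (val v)) x y.

Definition single_ribbon (R : {fset cell}) : Prop :=
  [/\ R != fset0, edge_connected R, skew_shifted R & {in R &, injective diagv}].

Definition is_head (R : {fset cell}) (h : cell) : Prop :=
  h \in R /\ {in R, forall x, (diagv x <= diagv h)%R}.

Definition is_tail (R : {fset cell}) (t : cell) : Prop :=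
  t \in R /\ {in R, forall x, (diagv t <= diagv x)%R}.

(* The union of R and S is a double ribbon in lam, decomposed as (R, S). *)
Definition double_ribbon (lam : seq nat) (R S : {fset cell}) : Prop :=
  [/\ single_ribbon R, single_ribbon S, [disjoint R & S]%fset,
      (R `|` S `<=` sdiagram lam)%fset & #|` S| <= #|` R|] /\
  [/\ (exists2 t, is_tail R t & t \in main_diag (sdiagram lam)),
      (exists2 t, is_tail S t & t \in main_diag (sdiagram lam `\` R)%fset)
    & skew_shifted (R `|` S)%fset].

Definition kribbon (k : nat) (lam : seq nat) (X : {fset cell}) : Prop :=
  #|` X| = k /\
  (single_ribbon X \/
   exists R S, double_ribbon lam R S /\ X = (R `|` S)%fset).

(* A relation rather than a function: a double ribbon may decompose in several
   ways. *)
Definition kribbon_head (lam : seq nat) (X : {fset cell}) (h : cell) : Prop :=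
  (single_ribbon X /\ is_head X h) \/
  (exists R S, [/\ double_ribbon lam R S, X = (R `|` S)%fset & is_head R h]).

Definition removable_kribbon (k : nat) (lam : seq nat) (X : {fset cell}) :
    Prop :=
  removable lam X /\ kribbon k lam X.

Definition kcore (k : nat) (lam : seq nat) : Prop :=
  strict_part lam /\ ~ exists X, removable_kribbon k lam X.

(* A tableau is its chain [:: lam^(0); ...; lam^(n)] of strict partitions, so
   that n = (size T).-1. *)
Definition tab_ribbon (T : seq (seq nat)) (i : nat) : {fset cell} :=
  (sdiagram (nth [::] T i) `\` sdiagram (nth [::] T i.-1))%fset.

Definition kribbon_tableau (k : nat) (lam : seq nat) (T : seq (seq nat)) :
    Prop :=
  [/\ T != [::], last [::] T = lam, all strict_part T, kcore k (nth [::] T 0)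
    & forall i, 0 < i < size T ->
        (sdiagram (nth [::] T i.-1) `<` sdiagram (nth [::] T i))%fset /\
        removable_kribbon k (nth [::] T i) (tab_ribbon T i)].

Definition kribbon_tableaux (k : nat) (lam : seq nat) : set (seq (seq nat)) :=
  [set T | kribbon_tableau k lam T]%classic.

(* alpha^(i), for 1 <= i <= k: every positive p congruent to i satisfies
   i <= p, and the division is exact. *)
Definition abacus (k : nat) (lam : seq nat) (i : nat) : seq nat :=
  [seq ((p - i) %/ k).+1 | p <- lam & p == i %[mod k]].

Record folded := Folded { underlying : {fset cell}; special_diag : pred cell }.

Definition combination (al be : seq nat) : folded :=
  let n := minn (size al) (size be) in
  let da := Posz (size al - n) in
  let db := Posz (size be - n) in
  @Folded
    ([fset ((z.2 - da)%R, (z.1 - da)%R)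
        | z in sdiagram al & (da < z.1)%R] `|`
     [fset ((z.1 - db)%R, (z.2 - db)%R)
        | z in sdiagram be & (db < z.1)%R])%fset
    [pred z : cell | z.1 == z.2].

Variant component :=
  | FoldedComp of folded
  | ShiftedComp of seq nat.

Definition comp_cells (c : component) : {fset cell} :=
  match c with
  | FoldedComp f => underlying f
  | ShiftedComp al => sdiagram al
  end.

Definition kquotient (k : nat) (lam : seq nat) : seq component :=
  let al := abacus k lam in
  let pairs m := [seq FoldedComp (combination (al i) (al (k - i)))
                    | i <- iota 1 m] in
  if odd k then pairs (k.-1)./2 ++ [:: ShiftedComp (al k)]
  else pairs (k./2).-1 ++ [:: FoldedComp (combination (al k./2) [::]);
                              ShiftedComp (al k)].

(* The cells of all components, each tagged with the index of its component. *)
Definition qcells (Q : seq component) : {fset nat * cell} :=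
  [fset ((j, z) : nat * cell)
     | j in iota 0 (size Q), z in comp_cells (nth (ShiftedComp [::]) Q j)]%fset.

Definition filling (Q : seq component) : Type := {ffun qcells Q -> nat}.

Definition std_filling (Q : seq component) (F : filling Q) : Prop :=
  [/\ perm_eq (codom F) (iota 1 #|` qcells Q|),
      (forall u v : qcells Q, (val u).1 = (val v).1 ->
         (val u).2.2 = (val v).2.2 -> ((val u).2.1 < (val v).2.1)%R ->
         F u < F v)
    & (forall u v : qcells Q, (val u).1 = (val v).1 ->
         (val u).2.1 = (val v).2.1 -> ((val u).2.2 < (val v).2.2)%R ->
         F u < F v)].

Definition std_fillings (Q : seq component) : set (filling Q) :=
  [set F | std_filling F]%classic.

Definition same_diag (Q : seq component) (u v : qcells Q) : Prop :=
  (val u).1 = (val v).1 /\ diagv (val u).2 = diagv (val v).2.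

(* Phi maps the ribbon labelled i of T to the cell of Phi T with entry i.  The
   two ribbons may belong to different tableaux. *)
Definition preserves_diagonals (k : nat) (lam : seq nat) (Q : seq component)
    (Phi : seq (seq nat) -> filling Q) : Prop :=
  forall T T', kribbon_tableau k lam T -> kribbon_tableau k lam T' ->
  forall i j, 0 < i < size T -> 0 < j < size T' ->
  forall h h', kribbon_head (nth [::] T i) (tab_ribbon T i) h ->
    kribbon_head (nth [::] T' j) (tab_ribbon T' j) h' ->
    diagv h = diagv h' ->
  exists u v, [/\ Phi T u = i, Phi T' v = j & same_diag u v].

(* Main.v *)
Require Import Defs.
From mathcomp Require Import all_boot all_order all_algebra.
From mathcomp Require Import finmap.
From mathcomp Require Import classical_sets functions.
From mathcomp Require Import zify.
Set Implicit Arguments.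
Unset Strict Implicit.
Unset Printing Implicit Defensive.
Import Order.TTheory GRing.Theory Num.Theory.

(* Counting cells by diagonal shows that removing a k-ribbon whose head lies on
   diagonal b replaces the part b by b - k if b > k, deletes the part k if
   b = k, and deletes the two parts b and k - b if b < k.  On the abacus this
   moves one bead of runner b one step down, or removes the lowest beads of two
   opposite runners.  Gluing opposite runners makes a two-sided Maya diagram, in
   which each of these operations is a single bead move, that is, the removal
   of a corner on a diagonal that depends only on b.  The cut |a - b| in the
   definition of the combination does not change, so the corner is removed
   without moving the other cells; conversely every corner arises from exactly
   one ribbon.  A tableau is thus a saturated chain of cell sets, and labelling
   each cell of the quotient by the step at which it appears is the bijection. *)

(** * Chains of finite sets and standard fillings *)

(** The cuts are stable because a bead that moves down stays on its runner, and a double ribbon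
    takes one bead from each of the runners [b] and [k - b], which are glued together. For even [k]
    the danger is the runner [k / 2], glued to the empty partition: losing its lowest bead would
    mean [b = k - b], that is, two equal parts, which strictness forbids. Hence [k < 2 b], and this
    also decides where the removal of two lowest beads is recorded: always at [b], on the runner
    that is not transposed, so that the central diagonal shared by both factors is counted once. A
    double ribbon may have several decompositions, and its head is only a relation. This is
    harmless: every decomposition yields a move with its own [b], and the cell removed by that move
    is the one labelled by the step. *)

Section Chains.
Local Open Scope fset_scope.
Variables (E : choiceType) (S : eqType) (x0 : S) (V : pred S).
Variables (D : S -> {fset E}) (step : S -> S -> Prop) (dom : rel E).

Definition maximal_in (A : {fset E}) (u : E) : Prop :=
  u \in A /\ {in A, forall v, ~~ dom u v}.

Hypothesis step_cell : forall x y, V x -> V y -> step x y ->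
  exists2 u, maximal_in (D x) u & D y = D x `\ u.
Hypothesis cell_step : forall x u, V x -> maximal_in (D x) u ->
  exists y, [/\ V y, step x y & D y = D x `\ u].
Hypothesis step_inj : forall x y y', V x -> V y -> V y' ->
  step x y -> step x y' -> D y = D y' -> y = y'.
Hypothesis exists_maximal : forall x, V x -> D x != fset0 ->
  exists u, maximal_in (D x) u.

Definition terminal (x : S) : Prop := forall y, V y -> ~ step x y.

Definition chain_to (x : S) (T : seq S) : Prop :=
  [/\ T != [::], last x0 T = x, all V T, terminal (nth x0 T 0)
    & forall i, 0 < i < size T -> step (nth x0 T i) (nth x0 T i.-1)].

(** The first shape that contains a cell is the one whose ribbon adds it, so its index is the label.
    [find] returns [size T] when no shape contains [u]. *)
Definition entry (T : seq S) (u : E) : nat := find (fun x => u \in D x) T.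

Definition standard_on (A : {fset E}) (G : E -> nat) : Prop :=
  [/\ {in A &, injective G}, {in A, forall u, 0 < G u <= #|` A|}
    & {in A &, forall u v, dom u v -> G u < G v}].

(** Inductions peel off the last element: the final shape is prescribed, while the initial core is
    not. *)
Lemma chain_to_rcons x T y : chain_to x (rcons T y) <->
  [/\ y = x, V x & (T = [::] /\ terminal x) \/
                   (exists2 z, chain_to z T & step x z)].
Proof.
split.
  case=> _; rewrite last_rcons all_rcons => <-{x} /andP[Vy VT] tm st; split=> //.
  case: T VT tm st => [|t T] VT tm st; first by left.
  right; exists (last x0 (t :: T)).
    split=> //; move=> i /andP[i0 iT].
    have := st i; rewrite size_rcons i0 (ltn_trans iT) // => /(_ isT).
    by rewrite !nth_rcons iT (leq_ltn_trans (leq_pred _) iT).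
  have := st (size (t :: T)); rewrite size_rcons ltnSn => /(_ isT).
  by rewrite !nth_rcons ltnn eqxx /= ltnSn -[in nth _ _ _]/((size (t :: T)).-1) nth_last.
case=> -> Vx [[-> tm]|[z [Tn lT VT tm st] sxz]].
  by split=> //=; [rewrite Vx | case=> [|[]]].
split; first by case: (T).
- by rewrite last_rcons.
- by rewrite all_rcons Vx.
- by rewrite nth_rcons; case: (T) Tn tm.
move=> i; rewrite size_rcons ltnS => /andP[i0 iT].
have iT' : i.-1 < size T by rewrite prednK.
rewrite !nth_rcons iT'.
move: iT; rewrite leq_eqVlt => /orP[/eqP iT|iT].
  by rewrite iT ltnn eqxx nth_last lT; exact: sxz.
by rewrite iT; apply: st; rewrite i0.
Qed.

Lemma chain_valid x T : chain_to x T -> V x.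
Proof. by elim/last_ind: T => [[]//|T y _] /chain_to_rcons[]. Qed.

(** A nonempty set has a maximal cell, and removing it is a step; this is why cores have an empty
    quotient. *)
Lemma terminal_empty x : V x -> terminal x -> D x = fset0.
Proof.
move=> Vx tm; apply/eqP; apply/negPn/negP => /(exists_maximal Vx)[u mu].
by have [y [Vy sy _]] := cell_step Vx mu; case: (tm y).
Qed.

Lemma chain_size x T : chain_to x T -> size T = (#|` D x|).+1.
Proof.
elim/last_ind: T x => [x []//|T y IH] x /chain_to_rcons[_ Vx [[-> tm]|]].
  by rewrite (terminal_empty Vx tm) cardfs0.
case=> z cz sxz; have [u [ux _] Dz] := step_cell Vx (chain_valid cz) sxz.
by rewrite size_rcons (IH _ cz) Dz (cardfsD1 u (D x)) ux.
Qed.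

Lemma chain_sub x T y : chain_to x T -> y \in T -> D y `<=` D x.
Proof.
elim/last_ind: T x => [x []//|T w IH] x /chain_to_rcons[-> Vx [[-> tm]|]].
  by rewrite inE => /eqP ->.
case=> z cz sxz; have [u [ux _] Dz] := step_cell Vx (chain_valid cz) sxz.
rewrite mem_rcons inE => /orP[/eqP->//|/(IH _ cz) /fsubset_trans]; apply.
by rewrite Dz fsubD1set.
Qed.

Lemma chain_entry_lt x T u : chain_to x T -> (entry T u < size T) = (u \in D x).
Proof.
move=> cT; rewrite -has_find; apply/hasP/idP => [[y yT /=]|ux].
  by move/(fsubsetP (chain_sub cT yT)).
by exists x => //; case: cT => Tn <- _ _ _; case: (T) Tn => //= t T' _; rewrite mem_last.
Qed.

Lemma entry_rcons x T u : u \in D x ->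
  entry (rcons T x) u = if has (fun y => u \in D y) T then entry T u else size T.
Proof.
by move=> ux; rewrite /entry -cats1 find_cat /= ux; case: ifP => // _; rewrite addn0.
Qed.

Lemma chain_entry_rcons x z T u : chain_to z T -> u \in D x ->
  entry (rcons T x) u = if u \in D z then entry T u else size T.
Proof. by move=> cz ux; rewrite entry_rcons // has_find -/(entry T u) (chain_entry_lt u cz). Qed.

(** The last step adds one cell, gives it the new largest label and leaves the other labels alone;
    since that cell is maximal, no cell has to carry a larger label. *)
Lemma chain_standard x T : chain_to x T -> standard_on (D x) (entry T).
Proof.
elim/last_ind: T x => [x []//|T w IH] x /chain_to_rcons[-> Vx [[-> tm]|]].
  by rewrite /standard_on (terminal_empty Vx tm); split=> u; rewrite inE.
case=> z cz sxz; have [u0 [ux mx] Dz] := step_cell Vx (chain_valid cz) sxz.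
have [inj rg mono] := IH _ cz; have sT := chain_size cz.
have card : #|` D x| = (#|` D z|).+1 by rewrite Dz (cardfsD1 u0 (D x)) ux.
have zE u : u \in D x -> (u \in D z) = (u != u0).
  by move=> uDx; rewrite Dz !inE uDx andbT.
have ent u : u \in D x -> entry (rcons T x) u = if u == u0 then size T else entry T u.
  by move=> uDx; rewrite (chain_entry_rcons cz) // zE //; case: eqP.
have rg' u : u \in D x -> u != u0 -> 0 < entry T u < size T.
  by move=> uDx ne; rewrite sT ltnS; apply: rg; rewrite zE.
split.
- move=> u v uD vD; rewrite !ent //.
  case: (eqVneq u u0) (rg' u uD) => [->|nu] ru; case: (eqVneq v u0) (rg' v vD) => [->|nv] rv //.
  + by move=> e; have := rv isT; rewrite -e ltnn andbF.
  + by move=> e; have := ru isT; rewrite e ltnn andbF.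
  + by apply: inj; rewrite zE.
- move=> u uD; rewrite ent // card; case: (eqVneq u u0) (rg' u uD) => [_ _|nu /(_ isT)].
    by rewrite sT /=.
  by rewrite sT ltnS => /andP[-> /leq_trans ->].
- move=> u v uD vD duv; rewrite !ent //.
  case: (eqVneq u u0) duv (rg' u uD) => [->|nu] duv ru; first by case/negP: (mx v vD).
  have /andP[_ ru'] := ru isT.
  case: (eqVneq v u0) => [_|nv]; first exact: ru'.
  by apply: mono => //; rewrite zE.
Qed.

Lemma standard_surj A G i : standard_on A G -> 0 < i <= #|` A| ->
  exists2 u, u \in A & G u = i.
Proof.
case=> inj rg _ hi.
have u1 : uniq [seq G u | u <- enum_fset A].
  by rewrite map_inj_in_uniq ?fset_uniq.
have sub : {subset [seq G u | u <- enum_fset A] <= iota 1 #|` A|}.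
  by move=> j /mapP[u uD ->]; rewrite mem_iota add1n ltnS; apply: rg.
have [|_ e] := uniq_min_size u1 sub; first by rewrite size_iota size_map.
have : i \in iota 1 #|` A| by rewrite mem_iota add1n ltnS.
by rewrite -e => /mapP[u uD ->]; exists u.
Qed.

(** The cell with the largest entry is maximal, since a dominating cell would carry a larger one.
    Its removal is therefore a step, and the rest follows by induction on the number of cells. *)
Lemma standard_chain x G : V x -> standard_on (D x) G ->
  exists2 T, chain_to x T & {in D x, entry T =1 G}.
Proof.
move: {2}#|` D x| (erefl #|` D x|) => n; elim: n x => [|n IH] x Dx Vx.
  move=> st; have D0 : D x = fset0 by apply/cardfs0_eq.
  exists [:: x]; last by move=> u; rewrite D0 inE.
  apply/(chain_to_rcons x [::] x); split=> //; left; split=> // y Vy sxy.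
  by have [u []] := step_cell Vx Vy sxy; rewrite D0 inE.
move=> st; have [inj rg mono] := st.
have [|u0 u0D Gu0] := standard_surj (i := n.+1) st; first by rewrite Dx leqnn.
have mx : maximal_in (D x) u0.
  split=> // v vD; apply/negP => /(mono _ _ u0D vD).
  by rewrite Gu0 ltnNge; case/andP: (rg v vD) => _; rewrite Dx => ->.
have [z [Vz sxz Dz]] := cell_step Vx mx.
have card : #|` D z| = n.
  by move: Dx; rewrite Dz (cardfsD1 u0 (D x)) u0D add1n => -[].
have sub u : u \in D z -> u \in D x /\ u != u0.
  by rewrite Dz !inE => /andP[].
have [|T cT eT] := IH z card Vz.
  split.
  - by move=> u v /sub[? _] /sub[? _]; apply: inj.
  - move=> u /sub[uD ne]; have := rg u uD; rewrite card Dx => /andP[-> le] /=.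
    move: le; rewrite leq_eqVlt => /orP[/eqP e|]; last by [].
    by case/eqP: ne; apply: inj => //; rewrite e Gu0.
  - by move=> u v /sub[? _] /sub[? _]; apply: mono.
exists (rcons T x); first by apply/chain_to_rcons; split=> //; right; exists z.
move=> u uD; rewrite (chain_entry_rcons cT) //.
case: ifP => [/eT //|/negbT]; rewrite Dz !inE uD andbT negbK => /eqP ->.
by rewrite Gu0 (chain_size cT) card.
Qed.

(** The cell added last carries the label [size T] in both chains, so injectivity of the labels
    identifies it, and [step_inj] then identifies the penultimate shapes. *)
Lemma chain_entry_inj x T T' : chain_to x T -> chain_to x T' ->
  {in D x, entry T =1 entry T'} -> T = T'.
Proof.
elim/last_ind: T x T' => [x T' []//|T w IH] x T'.
elim/last_ind: T' => [_ []//|T' w' _] cT cT'.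
have ss : size T = size T'.
  by have := chain_size cT; rewrite -(chain_size cT') !size_rcons => -[].
case/chain_to_rcons: cT (cT) => -> Vx cc cT.
case/chain_to_rcons: cT' (cT') => -> _ cc' cT' ag.
have [sT|sT] := eqVneq (size T) 0.
  by rewrite (size0nil sT); rewrite sT in ss; rewrite (size0nil (esym ss)).
have [z cz sxz] : exists2 z, chain_to z T & step x z by case: cc sT => [[->]|].
have [z' cz' sxz'] : exists2 z, chain_to z T' & step x z.
  by rewrite ss in sT; case: cc' sT => [[->]|].
have [u [ux _] Dz] := step_cell Vx (chain_valid cz) sxz.
have [u' [ux' _] Dz'] := step_cell Vx (chain_valid cz') sxz'.
have [inj _ _] := chain_standard cT.
have uu : u = u'.
  apply: inj => //; rewrite (ag u') //.
  by rewrite (chain_entry_rcons cz) // (chain_entry_rcons cz') // Dz Dz' !inE !eqxx.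
have zz : z = z'.
  apply: (step_inj Vx (chain_valid cz) (chain_valid cz')) => //.
  by rewrite Dz Dz' uu.
congr rcons; apply: (IH z) => //; first by rewrite zz.
move=> v vz; have vx : v \in D x by move: vz; rewrite Dz !inE => /andP[].
by have := ag v vx; rewrite (chain_entry_rcons cz) // (chain_entry_rcons cz') // -zz vz.
Qed.

Lemma chain_entry_nth x T i u : chain_to x T -> 0 < i < size T ->
  u \in D (nth x0 T i) -> u \notin D (nth x0 T i.-1) ->
  u \in D x /\ entry T u = i.
Proof.
elim/last_ind: T x => [x []//|T w IH] x /[dup] cT /chain_to_rcons[-> Vx [[-> tm]|]].
  by clear IH; case: i => [|[]].
case=> z cz sxz; rewrite size_rcons ltnS => /andP[i0 iT].
have sub : D z `<=` D x by apply: (chain_sub cT); rewrite mem_rcons inE;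
  apply/orP; right; case: cz => Tn <- _ _ _; case: (T) Tn => //= t T' _; rewrite mem_last.
have iT' : i.-1 < size T by rewrite prednK.
rewrite !nth_rcons iT'.
move: iT; rewrite leq_eqVlt => /orP[/eqP iT|iT].
  rewrite iT ltnn eqxx nth_last; have [_ -> _ _ _] := cz => ux uz; split=> //.
  by rewrite (chain_entry_rcons cz) // (negbTE uz).
rewrite iT => h1 h2; have [|uz ent] := IH z cz _ h1 h2; first by rewrite i0.
have ux := fsubsetP sub u uz; split=> //.
by rewrite (chain_entry_rcons cz) // uz.
Qed.

End Chains.

(** * Diagonal heights of shifted diagrams *)

(* The number of cells of diagonal value d in the shifted diagram of s. *)
Definition ht (s : seq nat) (d : nat) : nat := count (leq d) s.

Lemma strict_part_uniq s : strict_part s -> uniq s.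
Proof.
case/andP=> /(sorted_uniq (leT := gtn)) -> //; last by move=> x; apply: ltnn.
by move=> x y z /= h1 h2; apply: ltn_trans h2 h1.
Qed.

Lemma strict_part_pos s p : strict_part s -> p \in s -> 0 < p.
Proof. by case/andP=> _ h0 ps; rewrite lt0n; apply: contraNneq h0 => <-. Qed.

Lemma sorted_gtn_inj s t : sorted gtn s -> sorted gtn t -> s =i t -> s = t.
Proof.
apply: irr_sorted_eq => [x y z /= h1 h2|x /=]; [exact: ltn_trans h2 h1 | exact: ltnn].
Qed.

Definition to_part (s : seq nat) : seq nat := sort geq s.

Lemma perm_to_part s : perm_eq (to_part s) s.
Proof. by rewrite perm_sort. Qed.

Lemma to_part_strict s : uniq s -> 0 \notin s -> strict_part (to_part s).
Proof.
move=> us s0; rewrite /strict_part mem_sort s0 andbT.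
rewrite (@sorted_pairwise _ gtn); last by move=> x y z /= h1 h2; apply: ltn_trans h2 h1.
have srt : sorted geq (to_part s) by apply: sort_sorted => x y; rewrite /= leq_total.
have : uniq (to_part s) by rewrite sort_uniq.
rewrite sorted_pairwise in srt; last by move=> x y z /= h1 h2; apply: leq_trans h2 h1.
rewrite uniq_pairwise => un.
have := conj srt un => /andP; rewrite -pairwise_relI; apply: sub_pairwise => x y /=.
by rewrite ltn_neqAle eq_sym andbC.
Qed.

(** Row lengths and heights are conjugate. Beyond the last row the default [0] of [nth] stands for
    an empty row, which is correct for positive [d]. *)
Lemma leq_nth_ht s d r : sorted gtn s -> 0 < d -> (d <= nth 0 s r) = (r < ht s d).
Proof.
move=> + d0; elim: s r => [|x s IH] r /=; first by rewrite nth_nil ltn0 leqNgt d0.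
move=> ps; have srt := path_sorted ps; rewrite /ht /= -/(ht s d).
have lt0 : ~~ (d <= x) -> ht s d = 0.
  rewrite -ltnNge => xd; apply/eqP; rewrite -leqn0 leqNgt -has_count; apply/hasPn => y ys.
  have /allP/(_ y ys) /= yx : all (gtn x) s.
    by apply: order_path_min ps => a b c /= h1 h2; apply: ltn_trans h2 h1.
  by rewrite -ltnNge; apply: ltn_trans yx xd.
case: r => [|r] /=.
  by case: (leqP d x) lt0 => //= _ ->.
by rewrite IH //; case: (leqP d x) lt0 => //= _ ->.
Qed.

(** A diagonal of a shifted diagram is filled from row 1 without gaps, so its height decides
    membership. The successor turns the offset [c - r] into the diagonal value. *)
Lemma mem_sdiagram s (c r : int) : sorted gtn s ->
  ((c, r) \in sdiagram s) =
    [&& (1 <= r)%R, (r <= c)%R & (r <= Posz (ht s `|(c - r)%R|.+1))%R].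
Proof.
move=> ss; apply/imfset2P/and3P => /=.
  case=> r'; rewrite mem_iota => hr [c']; rewrite mem_iota => hc [-> ->] /=.
  have e : `|(Posz c' - Posz r')%R|.+1 = (c' - r').+1 by lia.
  have := @leq_nth_ht s (c' - r').+1 r'.-1 ss isT; rewrite e; split; lia.
case: c r => [c|c] [r|r] //= [h1 h2 h3]; try lia.
have e : `|(Posz c - Posz r)%R|.+1 = (c - r).+1 by lia.
rewrite e in h3.
have h := @leq_nth_ht s (c - r).+1 r.-1 ss isT.
exists r.
  have := count_size (leq (c - r).+1) s; rewrite -/(ht s _) mem_iota; lia.
exists c => //; rewrite mem_iota; lia.
Qed.

Lemma ht_size s : strict_part s -> ht s 1 = size s.
Proof.
by move=> ss; apply/eqP; rewrite -all_count; apply/allP => p; apply: strict_part_pos.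
Qed.

(** This is where strictness enters: heights drop by at most one from a diagonal to the next, and
    the drops occur at the parts. *)
Lemma ht_step s d : uniq s -> ht s d = ht s d.+1 + (d \in s).
Proof.
move=> us; rewrite /ht -(count_uniq_mem d us) -count_predUI.
rewrite -[LHS]addn0; congr addn; last first.
  apply/esym/eqP; rewrite -leqn0 leqNgt -has_count; apply/hasPn => x _ /=.
  by case: eqP => [->|]; rewrite ?ltnn ?andbF.
by apply: eq_count => x /=; rewrite leq_eqVlt orbC eq_sym.
Qed.

(** The multiplicity of a part is the jump of the heights there. Heights on positive diagonals do
    not see the value 0, which is excluded separately. *)
Lemma perm_ht s t : 0 \notin s -> 0 \notin t -> (forall d, ht s d.+1 = ht t d.+1) ->
  perm_eq s t.
Proof.
move=> s0 t0 e; rewrite /perm_eq; apply/allP => x _ /=; apply/eqP.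
case: x => [|x]; first by rewrite (count_memPn s0) (count_memPn t0).
have h u : ht u x.+1 = count_mem x.+1 u + ht u x.+2.
  rewrite /ht -count_predUI -[LHS]addn0; congr addn.
    by apply: eq_count => y /=; rewrite leq_eqVlt eq_sym.
  apply/esym/eqP; rewrite -leqn0 leqNgt -has_count; apply/hasPn => y _ /=.
  by case: eqP => [->|]; rewrite ?ltnn ?andbF.
by have := e x; rewrite !h e => /addIn.
Qed.

(** * Ribbons as moves on parts *)

Lemma exists_argmax (T : eqType) (f : T -> int) (s : seq T) : s != [::] ->
  exists2 x, x \in s & {in s, forall y, (f y <= f x)%R}.
Proof.
elim: s => // x [|y s] IH _.
  by exists x; rewrite ?inE // => z; rewrite inE => /eqP ->.
have [//|z zs mz] := IH.
case: (lerP (f z) (f x))%R => h.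
  exists x; first by rewrite inE eqxx.
  move=> w; rewrite inE => /orP[/eqP->//|/mz]; lia.
exists z; first by rewrite inE zs orbT.
by move=> w; rewrite inE => /orP[/eqP->|/mz//]; lia.
Qed.

Lemma enum_fset_neq0 (T : choiceType) (X : {fset T}) : X != fset0 -> enum_fset X != [::].
Proof.
by apply: contraNneq => e; apply/eqP/fsetP => x; rewrite -[x \in X]/(x \in enum_fset X) e !inE.
Qed.

(** * Cells counted by diagonal *)

Definition diag_count (X : {fset cell}) (d : int) : nat :=
  count (fun x => diagv x == d) (enum_fset X).

Lemma diag_countU X Y d : [disjoint X & Y]%fset ->
  diag_count (X `|` Y)%fset d = diag_count X d + diag_count Y d.
Proof.
move=> dXY; rewrite /diag_count -count_cat; apply/permP/uniq_perm.
- exact: fset_uniq.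
- rewrite cat_uniq !fset_uniq andbT /=; apply/hasPn => x xY.
  by apply/negP => xX; have := fdisjointP dXY x xX; rewrite xY.
- by move=> x; rewrite mem_cat in_fsetU.
Qed.

Lemma diag_countD X Y d : (Y `<=` X)%fset ->
  diag_count X d = diag_count Y d + diag_count (X `\` Y)%fset d.
Proof.
move=> YX; rewrite -diag_countU; last first.
  by apply/fdisjointP => z zY; rewrite inE zY.
congr (diag_count _ _).
apply/fsetP => z; rewrite !inE; case: (boolP (z \in Y)) => //= zY.
exact: (fsubsetP YX).
Qed.

Lemma diag_count_inj X d : {in X &, injective diagv} ->
  diag_count X d = (d \in [seq diagv x | x <- enum_fset X]).
Proof.
move=> inj; rewrite -count_uniq_mem ?map_inj_in_uniq ?fset_uniq //.
by rewrite count_map.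
Qed.

Lemma diag_count_sdiagram s d : sorted gtn s ->
  diag_count (sdiagram s) (Posz d.+1) = ht s d.+1.
Proof.
move=> ss; rewrite /diag_count -size_filter.
rewrite -(size_iota 1 (ht s d.+1)) -(size_map (fun r => (Posz (r + d), Posz r) : cell)).
apply/perm_size/uniq_perm; first by rewrite filter_uniq ?fset_uniq.
  by rewrite map_inj_uniq ?iota_uniq // => x y [].
move=> [c r]; rewrite mem_filter mem_sdiagram //; apply/idP/mapP.
  case/andP=> /eqP; rewrite /diagv /= => dz /and3P[h1 h2 h3].
  have e : `|(c - r)%R|.+1 = d.+1 by lia.
  rewrite e in h3; exists `|r|%N; first by rewrite mem_iota; lia.
  by congr pair; lia.
case=> r'; rewrite mem_iota /diagv => hr [-> ->] /=.
have -> : `|(Posz (r' + d) - Posz r')%R|.+1 = d.+1 by lia.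
lia.
Qed.

Lemma sdiagram_diag_pos s z : sorted gtn s -> z \in sdiagram s -> (1 <= diagv z)%R.
Proof. by case: z => c r ss; rewrite mem_sdiagram // /diagv /= => /and3P[]; lia. Qed.

Lemma adjacent_diagv (x y : cell) (d : int) :
  adjacent x y -> (diagv x < d)%R -> (diagv y <= d)%R.
Proof. by case: x y => a b [a' b']; rewrite /adjacent /diagv /=; lia. Qed.

(** A discrete intermediate value theorem: along a path of adjacent cells the diagonal value changes
    by one at each step. *)
Lemma connected_interval X x y (d : int) : edge_connected X -> x \in X -> y \in X ->
  (diagv x <= d <= diagv y)%R -> exists2 z, z \in X & diagv z = d.
Proof.
move=> cX xX yX; have /connectP[p] := cX [` xX]%fset [` yX]%fset.
move=> + e; rewrite (_ : diagv y = diagv (val (last [` xX]%fset p))); last by rewrite -e.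
rewrite (_ : diagv x = diagv (val [` xX]%fset)) //.
move: [` xX]%fset => {x xX y yX e} x.
elim: p x => [|y p IH] x /=.
  by move=> _ h; exists (val x); [exact: valP | apply: le_anti].
case/andP=> axy pp h; have [dx|dx] := eqVneq (diagv (val x)) d.
  by exists (val x) => //; exact: valP.
apply: (IH y pp); case/andP: h => h1 ->; rewrite andbT.
by apply: adjacent_diagv axy _; rewrite lt_neqAle dx.
Qed.

(** Connectedness leaves no gap among the diagonals and injectivity allows no repetition. The
    witness [a] is the value just before the tail, nonnegative because cells of shifted diagrams
    have diagonal value at least 1. *)
Lemma single_ribbon_diags R h : single_ribbon R -> is_head R h ->
  exists a : nat, [/\ forall d, diag_count R d = ((Posz a < d)%R && (d <= diagv h)%R) :> nat,
    Posz #|` R| = (diagv h - Posz a)%R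
  & forall t, is_tail R t -> diagv t = (Posz a + 1)%R].
Proof.
case=> R0 cR [l [m [sl sm ml eR]]] inj [hR mh].
have Rn := enum_fset_neq0 R0.
have [t tR mt] := exists_argmax (fun x => - diagv x)%R Rn.
have t1 : (1 <= diagv t)%R.
  have : t \in R by []. rewrite eR => /fsetDP[tl _].
  by case/andP: sl => sl _; apply: sdiagram_diag_pos tl.
have ei : [seq diagv x | x <- enum_fset R] =i
          [seq (diagv t + Posz n)%R | n <- iota 0 `|(diagv h - diagv t + 1)%R|].
  move=> d; apply/mapP/mapP => [[x xR ->]|[n]].
    have := mt x xR; have := mh x xR => ? ?.
    exists `|(diagv x - diagv t)%R|%N; rewrite ?mem_iota; lia.
  rewrite mem_iota => hn ->; have := mt h hR => ?.
  have [|z zR <-] := @connected_interval R t h (diagv t + Posz n)%R cR tR hR; first by lia.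
  by exists z.
exists `|(diagv t - 1)%R|%N; split.
- move=> d; rewrite diag_count_inj // ei; congr nat_of_bool; apply/mapP/idP.
    by case=> n; rewrite mem_iota => hn ->; have := mt h hR; lia.
  move=> hd; exists `|(d - diagv t)%R|%N; rewrite ?mem_iota; lia.
- have -> : #|` R| = size [seq diagv x | x <- enum_fset R] by rewrite size_map.
  rewrite (perm_size (uniq_perm _ _ ei)) ?map_inj_in_uniq ?fset_uniq ?iota_uniq //.
    by rewrite size_map size_iota; have := mt h hR; lia.
  by move=> x y _ _; lia.
- case=> c r [tR' mt']; have := mt _ tR'; have := mt' _ tR; lia.
Qed.

(* A ribbon with head on diagonal b turns the parts dropped k b into added k b.
   If b < k, it is a double ribbon and k - b is the head diagonal of its smaller
   half, whence the condition k < 2 b in move. *)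
Definition added (k b : nat) : seq nat := if k < b then [:: b - k] else [::].
Definition dropped (k b : nat) : seq nat := if b < k then [:: b; k - b] else [:: b].

Definition move (k : nat) (lam mu : seq nat) (b : nat) : Prop :=
  [/\ k < b.*2, strict_part lam, strict_part mu
    & perm_eq (added k b ++ lam) (dropped k b ++ mu)].

Lemma sorted_strict s : strict_part s -> sorted gtn s.
Proof. by case/andP. Qed.

Lemma ht_skew lam mu d : strict_part lam -> strict_part mu ->
  (sdiagram mu `<=` sdiagram lam)%fset ->
  ht lam d.+1 = ht mu d.+1 + diag_count (sdiagram lam `\` sdiagram mu)%fset (Posz d.+1).
Proof.
move=> sl sm ml; rewrite -!diag_count_sdiagram ?sorted_strict //.
exact: diag_countD.
Qed.

Lemma single_ribbon_head R : single_ribbon R -> exists h, is_head R h.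
Proof.
case=> R0 _ _ _.
have Rn := enum_fset_neq0 R0.
by have [h] := exists_argmax diagv Rn; exists h.
Qed.

Lemma kribbon_head_exists k lam X : kribbon k lam X -> exists h, kribbon_head lam X h.
Proof.
case=> _ [sX|[R [S [dRS ->]]]].
  by have [h hX] := single_ribbon_head sX; exists h; left.
by have [[/single_ribbon_head[h hR] _ _ _ _] _] := dRS; exists h; right; exists R, S.
Qed.

Lemma two_interval_move k lam mu p q : strict_part lam -> strict_part mu ->
  0 < q <= p -> k = p + q ->
  (forall d, ht lam d.+1 = ht mu d.+1 + (d < p) + (d < q)) -> move k lam mu p.
Proof.
move=> sl sm /andP[q0 qp] kE hh.
(* If [q = p], the height of [lam] would drop by at least two after diagonal [p], so [p] would be a
   repeated part. *)
have qp' : q < p.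
  rewrite ltn_neqAle qp andbT; apply/eqP => e.
  have := hh p.-1; have := hh p; rewrite prednK ?(leq_trans q0) //.
  by have := ht_step p (strict_part_uniq sl); have := ht_step p (strict_part_uniq sm); lia.
have e1 : added k p = [::] by rewrite /added ltnNge kE leq_addr.
have e2 : dropped k p = [:: p; q].
  by rewrite /dropped kE -[X in X < _]addn0 ltn_add2l q0 addKn.
split=> //; first by lia.
rewrite e1 e2; apply: perm_ht; first by case/andP: sl.
  by case/andP: sm => _ m0; rewrite mem_cat !inE negb_or m0 andbT; lia.
by move=> d; rewrite hh /ht count_cat /=; lia.
Qed.

Lemma kribbon_head_move lam mu h : strict_part lam -> strict_part mu ->
  (sdiagram mu `<=` sdiagram lam)%fset ->
  kribbon_head lam (sdiagram lam `\` sdiagram mu)%fset h ->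
  move #|` (sdiagram lam `\` sdiagram mu)%fset| lam mu `|diagv h|%N /\ (0 <= diagv h)%R.
Proof.
move=> sl sm ml; set X := (_ `\` _)%fset; have hX d := @ht_skew lam mu d sl sm ml.
rewrite -/X in hX; set k := #|` X|.
have l0 : 0 \notin lam by case/andP: sl.
have m0 : 0 \notin mu by case/andP: sm.
case=> [[sX hh]|[R [S [dRS eX hR]]]].
  have [a [cX kX _]] := single_ribbon_diags sX hh.
  have k0 : 0 < k by rewrite /k cardfs_gt0; case: sX.
  rewrite -/k in kX; split; last by lia.
  have bE : diagv h = Posz `|diagv h|%N by lia.
  split=> //; first by lia.
  apply: perm_ht; rewrite ?mem_cat ?negb_or ?l0 ?m0 ?andbT /added /dropped.
  - by case: ifP => h1; rewrite !inE; lia.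
  - by case: ifP => h1; rewrite !inE; lia.
  move=> d; have := hX d; rewrite cX /ht !count_cat => ->.
  by case: ifP; case: ifP => ? ? /=; lia.
have [[sR sS dsj sub cle] [[tR iR mR] [tS iS mS] _]] := dRS.
have [hS hhS] := single_ribbon_head sS.
have [a [cR kR tlR]] := single_ribbon_diags sR hR.
have [a' [cS kS tlS]] := single_ribbon_diags sS hhS.
have S0 : 0 < #|` S| by rewrite cardfs_gt0; case: sS.
(* Both tails lie on a main diagonal, so each half occupies the diagonals from 1 up to its size. *)
have a0 : a = 0.
  have := tlR _ iR; move: mR; rewrite !inE => /andP[_ /eqP ->]; lia.
have a'0 : a' = 0.
  have := tlS _ iS; move: mS; rewrite !inE => /andP[_ /eqP ->]; lia.
rewrite {}a0 {}a'0 in cR cS kR kS.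
have kk : k = #|` R| + #|` S|.
  by rewrite /k eX cardfsU; move/eqP: dsj => ->; rewrite cardfs0 subn0.
have hE : diagv h = Posz #|` R| by rewrite kR subr0.
rewrite hE absz_nat; split=> //.
apply: (two_interval_move sl sm _ kk); first by rewrite S0.
move=> d; rewrite hX eX diag_countU // cR cS hE -addnA !lez_nat.
have -> // : diagv hS = Posz #|` S| by rewrite kS subr0.
Qed.

Lemma interval_ribbon lam mu a b : strict_part lam -> strict_part mu -> a < b ->
  (forall d, ht lam d.+1 = ht mu d.+1 + (a <= d < b)) ->
  [/\ (sdiagram mu `<=` sdiagram lam)%fset,
      single_ribbon (sdiagram lam `\` sdiagram mu)%fset,
      #|` (sdiagram lam `\` sdiagram mu)%fset| = b - a
    & exists2 t, is_tail (sdiagram lam `\` sdiagram mu)%fset t & diagv t = (Posz a + 1)%R].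
Proof.
move=> sl sm ab hh; have [ol om] := (sorted_strict sl, sorted_strict sm).
have sub : (sdiagram mu `<=` sdiagram lam)%fset.
  by apply/fsubsetP => -[c r]; rewrite !mem_sdiagram //; have := hh `|(c - r)%R|%N; lia.
set X := (_ `\` _)%fset.
(* [cl d] is the topmost cell of [lam] on diagonal [d + 1]. Heights drop by at most one, so
   consecutive top cells are neighbours in a row or in a column. *)
pose cl d : cell := (Posz (ht lam d.+1 + d), Posz (ht lam d.+1)).
have memX z : reflect (exists2 d, a <= d < b & z = cl d) (z \in X).
  apply: (iffP idP).
    case: z => c r; rewrite inE !mem_sdiagram // => h.
    have e := hh `|(c - r)%R|%N; exists `|(c - r)%R|%N; first by lia.
    by rewrite /cl; congr pair; lia.
  case=> d hd ->; rewrite inE !mem_sdiagram //= /cl /=.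
  have -> : `|(Posz (ht lam d.+1 + d) - Posz (ht lam d.+1))%R|%N = d by lia.
  by have := hh d; lia.
have dcl d : diagv (cl d) = (Posz d + 1)%R by rewrite /diagv /cl /=; lia.
have aX : cl a \in X by apply/memX; exists a => //; rewrite leqnn.
have sX : single_ribbon X.
  split.
  - by apply/fset0Pn; exists (cl a).
  - have toa (n : nat) (x : X) : val x = cl (a + n) ->
      connect (fun u v : X => adjacent (val u) (val v)) x [` aX]%fset.
      elim: n x => [|n IH] x ex.
        by rewrite (_ : x = [` aX]%fset) ?connect0 //; apply: val_inj; rewrite ex addn0.
      have [d hd ed] := memX _ (valP x).
      have dn : d = a + n.+1 by move: (dcl d); rewrite -ed ex dcl; lia.
      have yX : cl (a + n) \in X by apply/memX; exists (a + n) => //; lia.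
      apply: connect_trans (IH [` yX]%fset erefl); apply: connect1.
      rewrite ex /= /adjacent /cl /= addnS.
      by have := ht_step (a + n).+1 (strict_part_uniq sl); lia.
    have tob (x : X) : connect (fun u v : X => adjacent (val u) (val v)) x [` aX]%fset.
      have [d hd ed] := memX _ (valP x).
      by apply: (toa (d - a)); rewrite ed; congr cl; lia.
    have sy : connect_sym (fun u v : X => adjacent (val u) (val v)).
      by apply: sym_connect_sym => x y; rewrite /adjacent; lia.
    by move=> x y; apply: connect_trans (tob x) _; rewrite sy; apply: tob.
  - by exists lam, mu; split.
  - by move=> x y /memX[d _ ->] /memX[d' _ ->]; rewrite !dcl => e; congr cl; lia.
have tl : is_tail X (cl a).
  by split=> // x /memX[d hd ->]; rewrite !dcl; lia.
split=> //; last by exists (cl a); rewrite ?dcl.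
have bX : cl b.-1 \in X by apply/memX; exists b.-1 => //; lia.
have hd : is_head X (cl b.-1).
  by split=> // x /memX[d hd ->]; rewrite !dcl; lia.
have [a' [_ kX /(_ _ tl)]] := single_ribbon_diags sX hd; rewrite dcl in kX; rewrite dcl; lia.
Qed.

Lemma move_kribbon k lam mu b : 0 < k -> move k lam mu b ->
  (sdiagram mu `<` sdiagram lam)%fset /\ kribbon k lam (sdiagram lam `\` sdiagram mu)%fset.
Proof.
move=> k0 [kb sl sm /permP pe].
have proper : (sdiagram mu `<=` sdiagram lam)%fset ->
  #|` (sdiagram lam `\` sdiagram mu)%fset| = k -> (sdiagram mu `<` sdiagram lam)%fset.
  move=> sub ck; rewrite fproperEneq sub andbT; apply/eqP => e.
  by move: ck; rewrite e fsetDv cardfs0; lia.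
have hk d := pe (leq d.+1); move: hk; rewrite /added /dropped.
have [bk|kb'] := ltnP b k => hk.
  (* [nu] is [lam] without the part [b]: the shape left by the larger half, from which the smaller
     half leads to [mu]. *)
  pose nu := to_part ((k - b) :: mu).
  have lE : perm_eq lam [:: b, k - b & mu].
    by apply/permP => P; have := pe P; rewrite /added /dropped bk ltnNge (ltnW bk).
  have ul := strict_part_uniq sl; rewrite (perm_uniq lE) in ul.
  have pn := perm_to_part ((k - b) :: mu).
  have snu : strict_part nu.
    apply: to_part_strict; first by case/andP: ul.
    by case/andP: sm => _ m0; rewrite inE negb_or m0 andbT; lia.
  have hnu d : ht nu d.+1 = (d < k - b) + ht mu d.+1 by rewrite /ht (permP pn).
  have hl d : ht lam d.+1 = (d < b) + ht nu d.+1.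
    by rewrite hnu /ht (permP lE).
  have [||s1 r1 c1 [t1 T1 e1]] := @interval_ribbon lam nu 0 b sl snu;
    [by lia | by move=> d; rewrite hl addnC |].
  have [||s2 r2 c2 [t2 T2 e2]] := @interval_ribbon nu mu 0 (k - b) snu sm;
    [by lia | by move=> d; rewrite hnu addnC |].
  have sub := fsubset_trans s2 s1.
  set R := (sdiagram lam `\` sdiagram nu)%fset in r1 c1 T1 *.
  set S := (sdiagram nu `\` sdiagram mu)%fset in r2 c2 T2 *.
  have eX : (sdiagram lam `\` sdiagram mu)%fset = (R `|` S)%fset.
    apply/fsetP => z; rewrite !inE; have := fsubsetP s1 z; have := fsubsetP s2 z.
    by case: (z \in sdiagram mu); case: (z \in sdiagram nu); case: (z \in sdiagram lam) => //= h1 h2;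
       rewrite ?(h1 isT) ?(h2 isT) //; try (by have := h1 isT); by have := h2 isT.
  have dRS : [disjoint R & S]%fset.
    by apply/fdisjointP => z; rewrite !inE => /andP[/negbTE -> _]; rewrite andbF.
  have cX : #|` (sdiagram lam `\` sdiagram mu)%fset| = k.
    by rewrite eX cardfsU; move/eqP: dRS => ->; rewrite cardfs0 !subn0 c1 c2 !subn0 subnKC // ltnW.
  split; first exact: proper.
  split=> //; right; exists R, S; split=> //; split; split=> //.
  - by rewrite -eX fsubDset fsubsetUr.
  - by rewrite c1 c2 !subn0 leq_subLR addnn ltnW.
  - exists t1 => //; rewrite !inE e1 /= andbT.
    by case: T1 => /fsetDP[].
  - exists t2 => //; rewrite !inE e2 /= andbT.
    by case: T2 => /fsetDP[tn tm] _; rewrite tn (fsubsetP s1 _ tn).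
  - by rewrite -eX; exists lam, mu.
have [||s1 r1 c1 _] := @interval_ribbon lam mu (b - k) b sl sm; first by lia.
  move=> d; have := hk d; rewrite /ht !count_cat.
  by case: ltnP => ? /=; lia.
have cX : #|` (sdiagram lam `\` sdiagram mu)%fset| = k by rewrite c1; lia.
by split; [exact: proper | split=> //; left].
Qed.

(** * Components of the quotient *)

(* The cells (c, r) of one component, on the diagonal e = c - r, are cut off
   above by the row U e and on the other sides by the removed columns of either
   factor (da for the transposed one, db for the other).  The flag s marks the
   shifted component, which has only the diagonals e >= 0. *)
Definition region (s : bool) (da db : nat) (U : int -> int) (c r : int) : bool :=
  [&& (1 - Posz da <= c)%R, (1 - Posz db <= r)%R, s ==> (r <= c)%R & (r <= U (c - r))%R].

(* The diagonals e >= 0 of al <> be come from be and the diagonals e <= 0 from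
   the transpose of al, where the topmost cell is found from its column. *)
Definition boundary (ha hb : nat -> nat) (da db : nat) (e : int) : int :=
  if (0 <= e)%R then (Posz (hb `|e|.+1) - Posz db)%R
  else (Posz (ha `|e|.+1) - Posz da - e)%R.

(** The first two conditions make the top cells trace a lattice path. The last two allow a top cell
    just outside the region, which encodes an empty diagonal. *)
Definition valid_boundary (s : bool) (da db : nat) (U : int -> int) : Prop :=
  forall e : int, s ==> (0 <= e)%R ->
    [/\ (U (e + 1) <= U e)%R, (U e <= U (e + 1) + 1)%R,
        (- Posz db <= U e)%R & (- Posz da <= U e + e)%R].

Lemma valid_boundary_mono s da db U (e : int) (n : nat) : valid_boundary s da db U ->
  s ==> (0 <= e)%R ->
  (U (e + Posz n) <= U e)%R /\ (U e + e <= U (e + Posz n) + e + Posz n)%R.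
Proof.
move=> vU se; elim: n => [|n [IH1 IH2]]; first by rewrite addr0; lia.
have /vU[h1 h2 _ _] : s ==> (0 <= e + Posz n)%R by lia.
have -> : (e + Posz n.+1 = e + Posz n + 1)%R by lia.
lia.
Qed.

(** * Corners of a region *)

Section Corner.
Variables (s : bool) (da db : nat) (U : int -> int).
Hypothesis vU : valid_boundary s da db U.

Lemma corner_maximal (e : int) : (s -> da = 0 /\ db = 0) -> s ==> (0 <= e)%R ->
  U (e + 1) = (U e - 1)%R ->
  (s ==> (0 < e)%R -> U (e - 1) = U e) ->
  [/\ region s da db U (U e + e) (U e),
      forall c : int, (U e + e < c)%R -> ~~ region s da db U c (U e)
    & forall r : int, (U e < r)%R -> ~~ region s da db U (U e + e) r].
Proof.
move=> sd se e1 e2; have [h1 h2 h3 h4] := vU se.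
have se1 : s ==> (0 <= e + 1)%R by lia.
split.
- have [k1 k2 k3 k4] := vU se1.
  have -> : (region s da db U (U e + e) (U e)) =
     [&& (1 - Posz da <= U e + e)%R, (1 - Posz db <= U e)%R & s ==> (0 <= e)%R].
    rewrite /region (_ : (U e + e - U e = e)%R); last by lia.
    by rewrite lexx andbT (_ : (U e <= U e + e)%R = (0 <= e)%R) //; lia.
  rewrite se andbT; apply/andP; split; last by lia.
  (* The corner is a genuine cell: the drop on the right gives [U e >= 1 - db], the flat step on the
     left gives [U e + e >= 1 - da]. The main diagonal of the shifted component has no left
     neighbour, but there both cuts vanish and the first bound suffices. *)
  have [s1|] := boolP (s ==> (0 < e)%R).
    have se0 : s ==> (0 <= e - 1)%R by lia.
    by have [j1 j2 j3 j4] := vU se0; have := e2 s1; lia.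
  by case: (s) sd se => // sd0 se0 _; have [da0 db0] := sd0 isT; lia.
- move=> c hc; apply/negP => /and4P[_ _ _ hr].
  have [] := valid_boundary_mono `|(c - U e - e - 1)%R|%N vU se1.
  rewrite (_ : (e + 1 + Posz `|(c - U e - e - 1)%R| = c - U e)%R); last by lia.
  lia.
- move=> r hr; apply/negP => /and4P[_ _ sr rU].
  have s1 : s ==> (0 < e)%R by lia.
  have se0 : s ==> (0 <= U e + e - r)%R by lia.
  have [] := valid_boundary_mono `|(r - U e - 1)%R|%N vU se0.
  rewrite (_ : (U e + e - r + Posz `|(r - U e - 1)%R| = e - 1)%R); last by lia.
  by rewrite (e2 s1); lia.
Qed.

Lemma maximal_corner (c r : int) : region s da db U c r ->
  ~~ region s da db U (c + 1) r -> ~~ region s da db U c (r + 1) ->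
  [/\ r = U (c - r), U (c - r + 1) = (U (c - r) - 1)%R, s ==> (0 <= c - r)%R
    & s ==> (0 < c - r)%R -> U (c - r - 1) = U (c - r)].
Proof.
case/and4P=> h1 h2 h3 h4 n1 n2.
have se : s ==> (0 <= c - r)%R by lia.
have [k1 k2 k3 k4] := vU se.
have u1 : (U (c - r + 1) < r)%R.
  rewrite ltNge; apply: contra n1 => hr; apply/and4P; split=> //; try lia.
  by rewrite (_ : (c + 1 - r = c - r + 1)%R) //; lia.
have rE : r = U (c - r) by lia.
split=> //; first by lia.
move=> s1; have se0 : s ==> (0 <= c - r - 1)%R by lia.
have [j1 j2 _ _] := vU se0; rewrite subrK in j1 j2.
have : (U (c - r - 1) < r + 1)%R; last by lia.
rewrite ltNge; apply: contra n2 => hr; apply/and4P; split=> //; try lia.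
by rewrite (_ : (c - (r + 1) = c - r - 1)%R) //; lia.
Qed.

(** Slopes lie between [-1] and [0] both before and after [U e0] is lowered by one. This leaves only
    slope [-1] on the right of [e0] and slope [0] on its left, which is a corner. *)
Lemma region_decrement U' (e0 : int) : valid_boundary s da db U' -> s ==> (0 <= e0)%R ->
  (forall e : int, s ==> (0 <= e)%R -> U' e = (U e - Posz (e == e0))%R) ->
  [/\ U (e0 + 1) = (U e0 - 1)%R, s ==> (0 < e0)%R -> U (e0 - 1) = U e0
    & forall c r : int, region s da db U' c r =
        region s da db U c r && ((c != U e0 + e0) || (r != U e0))%R].
Proof.
move=> vU' se eU.
have se1 : s ==> (0 <= e0 + 1)%R by lia.
split.
- have [h1 h2 _ _] := vU se; have [h1' h2' _ _] := vU' _ se.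
  by rewrite (eU _ se) (eU _ se1) eqxx in h1' h2'; lia.
- move=> s1; have se0 : s ==> (0 <= e0 - 1)%R by lia.
  have [h1 h2 _ _] := vU se0; have [h1' h2' _ _] := vU' _ se0.
  by rewrite subrK in h1 h2 h1' h2'; rewrite (eU _ se) (eU _ se0) eqxx in h1' h2'; lia.
move=> c r; rewrite /region; case: (boolP (s ==> (r <= c)%R)) => [sr|]; last by rewrite !andbF.
have sc : s ==> (0 <= c - r)%R by lia.
rewrite (eU _ sc); have [e|ne] := eqVneq (c - r)%R e0; last first.
  by have -> : ((c != U e0 + e0) || (r != U e0))%R by [lia | lia]; lia.
rewrite e; lia.
Qed.

End Corner.

Definition slow (h : nat -> nat) : Prop := forall d, h d.+2 <= h d.+1 <= (h d.+2).+1.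

Lemma slow_ht l : uniq l -> slow (ht l).
Proof. by move=> ul d; rewrite (ht_step d.+1 ul); case: (_ \in _); lia. Qed.

Lemma slow_le h n : slow h -> h n.+1 <= h 1 <= h n.+1 + n.
Proof. by move=> sh; elim: n => [|n IH]; [lia | have := sh n; lia]. Qed.

(** The truncated differences bring both central heights down to [minn (ha 1) (hb 1)], so the two
    halves of the path meet at [e = 0]. *)
Lemma boundary_valid s ha hb : slow ha -> slow hb ->
  valid_boundary s (ha 1 - hb 1) (hb 1 - ha 1) (boundary ha hb (ha 1 - hb 1) (hb 1 - ha 1)).
Proof.
move=> sa sb [n|n] _; rewrite /boundary.
  have -> : (0 <= Posz n)%R by [].
  have -> : (0 <= Posz n + 1)%R by lia.
  have -> : `|(Posz n + 1)%R|%N = n.+1 by lia.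
  by have := sb n; have := slow_le n sb; rewrite absz_nat; split; lia.
have -> : (0 <= Negz n)%R = false by [].
have -> : `|Negz n|%N = n.+1 by [].
have := sa n; have := slow_le n sa; have := slow_le n.+1 sa.
case: n => [|n] h1 h2 h3.
  have -> : (Negz 0 + 1 = 0)%R by [].
  by rewrite lexx absz0; split; lia.
have -> : (Negz n.+1 + 1 = Negz n)%R by lia.
have -> : (0 <= Negz n)%R = false by [].
have -> : `|Negz n|%N = n.+1 by [].
split; lia.
Qed.

Lemma boundary_valid_shifted ha hb : slow hb -> valid_boundary true 0 0 (boundary ha hb 0 0).
Proof.
move=> sb [n|n] //= _; rewrite /boundary.
have -> : (0 <= Posz n)%R by [].
have -> : (0 <= Posz n + 1)%R by lia.
have -> : `|(Posz n + 1)%R|%N = n.+1 by lia.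
by have := sb n; rewrite absz_nat; split; lia.
Qed.

Lemma sdiagram_region ha s (c r : int) : sorted gtn s ->
  ((c, r) \in sdiagram s) = region true 0 0 (boundary ha (ht s) 0 0) c r.
Proof.
move=> ss; rewrite mem_sdiagram // /region /= /boundary.
have [rc|rc] := boolP (r <= c)%R; last by rewrite !andbF.
have -> : (0 <= c - r)%R by lia.
lia.
Qed.

Lemma mem_transposed (X : {fset cell}) (d c r : int) :
  ((c, r) \in [fset ((z.2 - d)%R, (z.1 - d)%R) | z in X & (d < z.1)%R]%fset) =
  ((r + d, c + d)%R \in X) && (0 < r)%R.
Proof.
apply/imfsetP/andP => /= [[[x y] /=]|[zX r0]].
  by rewrite !inE => /andP[/= zX xd] [-> ->]; rewrite !subrK subr_gt0.
exists (r + d, c + d)%R; last by rewrite /= !addrK.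
by rewrite !inE zX /= ltrDr.
Qed.

Lemma mem_translated (X : {fset cell}) (d c r : int) :
  ((c, r) \in [fset ((z.1 - d)%R, (z.2 - d)%R) | z in X & (d < z.1)%R]%fset) =
  ((c + d, r + d)%R \in X) && (0 < c)%R.
Proof.
apply/imfsetP/andP => /= [[[x y] /=]|[zX r0]].
  by rewrite !inE => /andP[/= zX xd] [-> ->]; rewrite !subrK subr_gt0.
exists (c + d, r + d)%R; last by rewrite /= !addrK.
by rewrite !inE zX /= ltrDr.
Qed.

(** At most one cut is nonzero, so on each half deleting the leftmost columns amounts to the bounds
    on [c] and [r] in [region]. The central diagonal comes from both factors, which have equal
    heights there after the cut. *)
Lemma combination_region al be (c r : int) : strict_part al -> strict_part be ->
  ((c, r) \in underlying (combination al be)) =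
  region false (ht al 1 - ht be 1) (ht be 1 - ht al 1)
    (boundary (ht al) (ht be) (ht al 1 - ht be 1) (ht be 1 - ht al 1)) c r.
Proof.
move=> sa sb; have [oa ob] := (sorted_strict sa, sorted_strict sb).
rewrite /combination /= -(ht_size sa) -(ht_size sb) in_fsetU.
rewrite !(_ : forall x y, x - minn x y = x - y) //; last by move=> x y; lia.
rewrite (_ : ht be 1 - minn (ht al 1) (ht be 1) = ht be 1 - ht al 1); last by lia.
set da := ht al 1 - _; set db := ht be 1 - _.
rewrite /region /= /boundary.
have la := slow_le _ (slow_ht (strict_part_uniq sa)).
have lb := slow_le _ (slow_ht (strict_part_uniq sb)).
rewrite mem_transposed mem_translated !mem_sdiagram //.
have -> : (r + Posz da - (c + Posz da) = r - c)%R by lia.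
have -> : (c + Posz db - (r + Posz db) = c - r)%R by lia.
have -> : `|(r - c)%R|%N = `|(c - r)%R|%N by lia.
have := la `|(c - r)%R|%N; have := lb `|(c - r)%R|%N.
case: (lerP 0 (c - r)%R) => e0 l1 l2; last by lia.
have [e1|e1] := eqVneq (c - r)%R 0%R; last by lia.
by rewrite e1 absz0 in l1 l2 *; lia.
Qed.

(** * Bead moves and corners *)

Section Abacus.
Variable k : nat.
Hypothesis k0 : 0 < k.

(* Part p sits in row level p, counted from 0, of runner residue p, where the
   runners are numbered 1, ..., k. *)
Definition residue (p : nat) : nat := (p.-1 %% k).+1.
Definition level (p : nat) : nat := p.-1 %/ k.

Lemma residue_bounds p : 0 < residue p <= k.
Proof. by rewrite /residue ltn_mod. Qed.

Lemma residue_level p : 0 < p -> p = level p * k + residue p.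
Proof. by move=> p0; rewrite /residue /level addnS -divn_eq prednK. Qed.

Lemma residueE l i : 0 < i <= k -> residue (l * k + i) = i.
Proof.
case: i => // i /= ik; rewrite /residue addnS /= modnMDl modn_small //.
Qed.

Lemma levelE l i : 0 < i <= k -> level (l * k + i) = l.
Proof.
by case: i => // i /= ik; rewrite /level addnS /= divnMDl // divn_small // addn0.
Qed.

Lemma eqmod_residue p i : 0 < p -> 0 < i <= k -> (p == i %[mod k]) = (residue p == i).
Proof.
move=> p0 ik; rewrite {1}(residue_level p0) modnMDl.
have := residue_bounds p; move: (residue p) => r rk.
have [rE|rE] := eqVneq r k; have [iE|iE] := eqVneq i k.
- by rewrite rE iE !eqxx.
- by rewrite rE modnn modn_small; lia.
- by rewrite iE modnn modn_small; lia.
- by rewrite !modn_small; lia.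
Qed.

Lemma abacus_level p i : 0 < p -> 0 < i <= k -> p == i %[mod k] -> (p - i) %/ k = level p.
Proof.
move=> p0 ik; rewrite eqmod_residue // => /eqP <-.
by rewrite {1}(residue_level p0) addnK mulnK.
Qed.

Lemma abacus_strict lam i : strict_part lam -> 0 < i <= k -> strict_part (abacus k lam i).
Proof.
move=> sl ik; apply/andP; split; last by apply/mapP => -[].
apply: (@homo_sorted_in _ _ [pred p | (p == i %[mod k]) && (0 < p)] _ gtn gtn).
- move=> p q /andP[pi p0] /andP[qi q0] /=; rewrite !abacus_level // => qp.
  rewrite ltnS -(ltn_pmul2r k0) -(ltn_add2r i).
  move: pi qi; rewrite !eqmod_residue // => /eqP pi /eqP qi.
  by rewrite -{1}qi -pi -!residue_level.
- apply/allP => p; rewrite mem_filter => /andP[pi pl] /=.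
  by rewrite pi (strict_part_pos sl).
- apply: sorted_filter; last exact: sorted_strict.
  by move=> x y z /= h1 h2; apply: ltn_trans h2 h1.
Qed.

Lemma ht_abacus lam i m : strict_part lam -> 0 < i <= k ->
  ht (abacus k lam i) m = count (fun p => (residue p == i) && (m <= (level p).+1)) lam.
Proof.
move=> sl ik; rewrite /ht /abacus count_map count_filter.
apply: eq_in_count => p pl /=; have p0 := strict_part_pos sl pl.
rewrite -eqmod_residue // andbC; case: eqP => //= e.
by rewrite abacus_level //; apply/eqP.
Qed.

Lemma mem_abacus lam i m : strict_part lam -> 0 < i <= k ->
  (m.+1 \in abacus k lam i) = (m * k + i \in lam).
Proof.
move=> sl ik; apply/mapP/idP => [[p]|h].
  rewrite mem_filter => /andP[pi pl] [->]; have p0 := strict_part_pos sl pl.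
  rewrite abacus_level //; move: pi; rewrite eqmod_residue // => /eqP <-.
  by rewrite -residue_level.
have p0 : 0 < m * k + i by lia.
have pi : m * k + i == i %[mod k] by rewrite eqmod_residue // residueE.
by exists (m * k + i); rewrite ?mem_filter ?pi // abacus_level // levelE.
Qed.

Lemma ht_abacus_step lam i m : strict_part lam -> 0 < i <= k ->
  ht (abacus k lam i) m.+1 = ht (abacus k lam i) m.+2 + (m * k + i \in lam).
Proof.
move=> sl ik; rewrite -mem_abacus //; apply: ht_step.
exact/strict_part_uniq/abacus_strict.
Qed.

Lemma move_gt0 lam mu b : move k lam mu b -> 0 < b.
Proof. by case; case: b => //; rewrite ltn0. Qed.

(** The height at [m.+1] of a runner counts the beads at level [m] or more, so shifting a bead down
    by one level changes a single height. The last term is the lowest bead of runner [k - b], which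
    a double ribbon takes along. *)
Lemma move_abacus lam mu b i m : move k lam mu b -> 0 < i <= k ->
  ht (abacus k lam i) m.+1 = ht (abacus k mu i) m.+1
    + ((i == residue b) && (m == level b)) + [&& b < k, i == k - b & m == 0].
Proof.
move=> /[dup] /move_gt0 b0 [kb sl sm /permP pe] ik; rewrite !ht_abacus //.
have := pe (fun p => (residue p == i) && (m < (level p).+1)).
have bE := residue_level b0; have bk := residue_bounds b.
rewrite !count_cat /added /dropped.
have small p : 0 < p <= k -> residue p = p /\ level p = 0.
  by move=> hp; have := levelE 0 hp; have := residueE 0 hp; rewrite mul0n add0n => -> ->.
case: (ltngtP b k) => hb /=.
- have [r1 l1] : residue b = b /\ level b = 0 by apply: small; lia.
  have [r2 l2] : residue (k - b) = k - b /\ level (k - b) = 0 by apply: small; lia.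
  rewrite r1 l1 r2 l2; lia.
- have l1 : 0 < level b by case: (level b) bE => //; lia.
  have e : b - k = (level b).-1 * k + residue b.
    by case: (level b) l1 bE => // l _; rewrite mulSn /=; lia.
  rewrite e residueE // levelE //; lia.
- have [r1 l1] : residue b = b /\ level b = 0 by apply: small; lia.
  rewrite r1 l1; lia.
Qed.

(* Component j of the quotient glues left_runner and right_runner, transposing
   the former; the last component is the right runner alone. *)
Definition left_runner (lam : seq nat) (j : nat) : seq nat :=
  if j < k./2 then abacus k lam j.+1 else [::].
Definition right_runner (lam : seq nat) (j : nat) : seq nat :=
  if j < k./2 then (if k == j.+1.*2 then [::] else abacus k lam (k - j.+1))
  else abacus k lam k.
Definition left_cut lam j : nat :=
  if j < k./2 then ht (left_runner lam j) 1 - ht (right_runner lam j) 1 else 0.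
Definition right_cut lam j : nat :=
  if j < k./2 then ht (right_runner lam j) 1 - ht (left_runner lam j) 1 else 0.
Definition rim lam j : int -> int :=
  boundary (ht (left_runner lam j)) (ht (right_runner lam j)) (left_cut lam j) (right_cut lam j).

Lemma left_runner_strict lam j : strict_part lam -> strict_part (left_runner lam j).
Proof. by move=> sl; rewrite /left_runner; case: ifP => // h; apply: abacus_strict; lia. Qed.

Lemma right_runner_strict lam j : strict_part lam -> strict_part (right_runner lam j).
Proof.
move=> sl; rewrite /right_runner; case: ifP => h; last by apply: abacus_strict; lia.
by case: ifP => // h'; apply: abacus_strict; lia.
Qed.

Lemma size_kquotient lam : size (kquotient k lam) = k./2.+1.
Proof. by rewrite /kquotient; case: ifP => ok; rewrite size_cat size_map size_iota /=; lia. Qed.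

Lemma nth_kquotient lam j : j <= k./2 ->
  nth (ShiftedComp [::]) (kquotient k lam) j =
  if j < k./2 then FoldedComp (combination (left_runner lam j) (right_runner lam j))
  else ShiftedComp (right_runner lam j).
Proof.
move=> jk; rewrite /left_runner /right_runner /kquotient.
case: ifP => ok; rewrite nth_cat size_map size_iota.
  have -> : k.-1./2 = k./2 by lia.
  case: ltnP => h; last by rewrite (_ : j - k./2 = 0) //; lia.
  rewrite (nth_map 0) ?size_iota // nth_iota // add1n.
  by rewrite ifF //; lia.
case: ltnP => h.
  rewrite (nth_map 0) ?size_iota // nth_iota // add1n.
  have -> : (j < k./2) = true by lia.
  by rewrite ifF //; lia.
case: ltnP => h2; last by rewrite (_ : j - k./2.-1 = 1) //; lia.
have e : j.+1 = k./2 by lia.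
rewrite (_ : j - k./2.-1 = 0); last by lia.
by rewrite e ifT //; lia.
Qed.

Lemma mem_qcells lam j (c r : int) : strict_part lam ->
  ((j, (c, r)) \in qcells (kquotient k lam)) =
  (j <= k./2) && region (j == k./2) (left_cut lam j) (right_cut lam j) (rim lam j) c r.
Proof.
move=> sl; have -> : ((j, (c, r)) \in qcells (kquotient k lam)) =
   (j <= k./2) && ((c, r) \in comp_cells (nth (ShiftedComp [::]) (kquotient k lam) j)).
  apply/imfset2P/andP => /= [[j' + [z zj [-> ->]]]|[jk h]].
    by rewrite mem_iota size_kquotient => /= ?; split.
  exists j; first by rewrite mem_iota size_kquotient.
  by exists (c, r).
case: (boolP (j <= k./2)) => //= jk; rewrite nth_kquotient //.
rewrite /rim /left_cut /right_cut; case: ltnP => h /=.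
  by rewrite combination_region ?left_runner_strict ?right_runner_strict // ltn_eqF.
rewrite (_ : j == k./2); last by rewrite eqn_leq jk h.
exact/sdiagram_region/sorted_strict/right_runner_strict.
Qed.

Lemma rim_valid lam j : strict_part lam -> j <= k./2 ->
  valid_boundary (j == k./2) (left_cut lam j) (right_cut lam j) (rim lam j).
Proof.
move=> sl jk; rewrite /rim /left_cut /right_cut.
have sL := slow_ht (strict_part_uniq (left_runner_strict j sl)).
have sR := slow_ht (strict_part_uniq (right_runner_strict j sl)).
case: ltnP => h; first exact: boundary_valid.
rewrite (_ : j == k./2); last by rewrite eqn_leq jk h.
exact: boundary_valid_shifted.
Qed.

Lemma shifted_uncut lam j : j == k./2 -> left_cut lam j = 0 /\ right_cut lam j = 0.
Proof. by move/eqP => ->; rewrite /left_cut /right_cut ltnn. Qed.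

(* The component and the diagonal c - r of the cell that corresponds to a ribbon
   with head on diagonal b. *)
Definition quotient_comp (b : nat) : nat :=
  if residue b == k then k./2 else (minn (residue b) (k - residue b)).-1.
Definition quotient_content (b : nat) : int :=
  if k < (residue b).*2 then Posz (level b) else (- Posz (level b))%R.

Lemma quotient_comp_le b : quotient_comp b <= k./2.
Proof. by rewrite /quotient_comp; have := residue_bounds b; case: ifP; lia. Qed.

Lemma quotient_shifted b : (quotient_comp b == k./2) ==> (0 <= quotient_content b)%R.
Proof.
rewrite /quotient_comp /quotient_content; have := residue_bounds b.
by case: ifP; case: ifP; lia.
Qed.

Lemma move_level lam mu b : move k lam mu b ->
  (b < k) = (level b == 0) && (residue b < k) /\ (level b = 0 -> residue b = b).
Proof.
move=> /move_gt0 b0; have bE := residue_level b0; have bk := residue_bounds b.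
by case: (level b) bE => [|l] bE; rewrite ?mul0n ?mulSn in bE; lia.
Qed.

(** A negative diagonal sees only positive levels of the left runner, hence never the partner bead
    [k - b] at level 0. *)
Lemma move_left_cell lam mu b j (e : int) : move k lam mu b -> j < k./2 -> (e < 0)%R ->
  ((j.+1 == residue b) && (`|e|%N == level b)) + [&& b < k, j.+1 == k - b & `|e|%N == 0]
  = (j == quotient_comp b) && (e == quotient_content b) :> nat.
Proof.
move=> /[dup] mv [kb _ _ _] jk e0; have := residue_bounds b; have [_ bl] := move_level mv.
rewrite /quotient_comp /quotient_content.
move: (residue b) (level b) bl => r l {mv} bl rk.
have /negbTE -> : `|e|%N != 0 by lia.
rewrite !andbF addn0; congr nat_of_bool.
case: (ltnP k r.*2) => h.
  have /negbTE -> : j.+1 != r by lia.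
  have /negbTE -> : e != Posz l by lia.
  by rewrite andbF.
have /negbTE -> : r != k by lia.
have -> : minn r (k - r) = r by lia.
have -> : (e == - Posz l)%R = (`|e|%N == l) by apply/eqP/eqP; lia.
by congr andb; apply/eqP/eqP; lia.
Qed.

(** If the partner [k - b] sat on the right runner, [b] would be at most [k / 2]. For the same
    reason a bead [b] of the left runner has positive level and stays off the diagonals [e >= 0]. *)
Lemma move_right_cell lam mu b j (e : int) : move k lam mu b -> j < k./2 -> (0 <= e)%R ->
  k != j.+1.*2 ->
  ((k - j.+1 == residue b) && (`|e|%N == level b)) +
    [&& b < k, k - j.+1 == k - b & `|e|%N == 0]
  = (j == quotient_comp b) && (e == quotient_content b) :> nat.
Proof.
move=> /[dup] mv [kb _ _ _] jk e0 jk'; have := residue_bounds b; have [_ bl] := move_level mv.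
have -> : [&& b < k, k - j.+1 == k - b & `|e|%N == 0] = false.
  by apply/negP => /and3P[hb /eqP hj _]; lia.
rewrite addn0 /quotient_comp /quotient_content.
move: (residue b) (level b) bl => r l {mv} bl rk; congr nat_of_bool.
case: (ltnP k r.*2) => h.
  have -> : (e == Posz l)%R = (`|e|%N == l) by apply/eqP/eqP; lia.
  congr andb; case: (eqVneq r k) => rE.
    have /negbTE -> : j != k./2 by lia.
    by apply/negbTE; lia.
  have -> : minn r (k - r) = k - r by lia.
  by apply/eqP/eqP; lia.
have /negbTE -> : k - j.+1 != r by lia.
have l0 : l != 0 by apply/eqP => l0; have := bl l0; lia.
have /negbTE -> : e != (- Posz l)%R by lia.
by rewrite andbF.
Qed.

Lemma move_center_cell lam mu b (e : int) : move k lam mu b -> (0 <= e)%R ->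
  ((k == residue b) && (`|e|%N == level b)) + [&& b < k, k == k - b & `|e|%N == 0]
  = (k./2 == quotient_comp b) && (e == quotient_content b) :> nat.
Proof.
move=> /move_gt0 b0 e0; have := residue_bounds b.
have -> : [&& b < k, k == k - b & `|e|%N == 0] = false.
  by apply/negP => /and3P[hb /eqP hj _]; lia.
rewrite addn0 /quotient_comp /quotient_content.
move: (residue b) (level b) => r l rk; congr nat_of_bool; rewrite eq_sym.
case: (eqVneq r k) => rE /=.
  have -> : k < r.*2 by lia.
  by rewrite eqxx /=; apply/eqP/eqP; lia.
have /negbTE -> // : k./2 != (minn r (k - r)).-1 by lia.
Qed.

Lemma move_rim lam mu b j : move k lam mu b -> j <= k./2 ->
  [/\ left_cut mu j = left_cut lam j, right_cut mu j = right_cut lam j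
    & forall e : int, (j == k./2) ==> (0 <= e)%R ->
      rim mu j e = (rim lam j e - Posz ((j == quotient_comp b) && (e == quotient_content b)))%R].
Proof.
move=> mv jk; have mA i m := @move_abacus lam mu b i m mv.
have cuts : left_cut mu j = left_cut lam j /\ right_cut mu j = right_cut lam j.
  have [kb _ _ _] := mv; have [blt bl] := move_level mv; have bk := residue_bounds b.
  rewrite /left_cut /right_cut /left_runner /right_runner; case: ltnP => // h.
  have i1 : 0 < j.+1 <= k by lia.
  have i2 : 0 < k - j.+1 <= k by lia.
  have h1 := mA _ 0 i1; have h2 := mA _ 0 i2.
  (* In the middle component of an even [k], only the bead [k / 2] could change the cut, and
     [k < 2 b] excludes it. *)
  case: ifP => h'.
    suff e : ht (abacus k lam j.+1) 1 = ht (abacus k mu j.+1) 1 by rewrite e.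
    rewrite h1; set x := (_ && _); set y := [&& _, _ & _].
    have /negbTE -> : ~~ x by apply/negP => /andP[/eqP ? /eqP l0]; have := bl (esym l0); lia.
    have /negbTE -> : ~~ y by apply/negP => /and3P[? /eqP ? _]; lia.
    by rewrite !addn0.
  (* Both runners of the pair lose equally many beads, one each or none, so the differences defining
     the cuts survive. *)
  suff e : ((j.+1 == residue b) && (0 == level b)) + [&& b < k, j.+1 == k - b & 0 == 0] =
           ((k - j.+1 == residue b) && (0 == level b)) + [&& b < k, k - j.+1 == k - b & 0 == 0].
    by rewrite -!addnA e in h1 h2; rewrite h1 h2 !subnDr.
  case: (eqVneq 0 (level b)) => l0; last by rewrite !andbF blt eq_sym (negbTE l0).
  have rb := bl (esym l0).
  rewrite rb !andbT; case: (ltnP b k) => hb /=.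
    have -> : (j.+1 == b) = (k - j.+1 == k - b) by apply/eqP/eqP; lia.
    have -> : (k - j.+1 == b) = (j.+1 == k - b) by apply/eqP/eqP; lia.
    by rewrite addnC.
  have /negbTE -> : j.+1 != b by lia.
  by have /negbTE -> : k - j.+1 != b by lia.
case: cuts => e1 e2; split=> // e se; rewrite /rim e1 e2 /boundary.
move: (left_cut lam j) (right_cut lam j) => da db {e1 e2}.
rewrite /left_runner /right_runner.
case: ltnP => h.
  case: (lerP 0 e) => e0.
    case: ifP => h'.
      (* The right runner is empty here, so the moved cell must not lie on a nonnegative diagonal of
         this component. *)
      rewrite (_ : (j == _) && (e == _) = false) ?subr0 //.
      apply/negP => /andP[/eqP jE /eqP eE].
      have [kb _ _ _] := mv; have [_ bl] := move_level mv; have bk := residue_bounds b.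
      move: jE eE; rewrite /quotient_comp /quotient_content.
      case: (ltnP k (residue b).*2) => hk; first by case: ifP; lia.
      move=> _ eE; have l0 : level b = 0 by lia.
      have rb := bl l0.
      lia.
    have i2 : 0 < k - j.+1 <= k by lia.
    have := mA _ `|e|%N i2; rewrite -addnA (move_right_cell mv) ?h' //.
    by move: (_ && _ : bool) => x; lia.
  have i1 : 0 < j.+1 <= k by lia.
  have := mA _ `|e|%N i1; rewrite -addnA (move_left_cell mv) //.
  by move: (_ && _ : bool) => x; lia.
have jE : j = k./2 by lia.
have e0 : (0 <= e)%R by move: se; rewrite jE eqxx.
have i1 : 0 < k <= k by lia.
rewrite e0; have := mA _ `|e|%N i1; rewrite -addnA (move_center_cell mv) // -jE.
by move: (_ && _ : bool) => x; lia.
Qed.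

(** * Moves recovered from corners *)

Lemma move_exists lam b : strict_part lam -> b \in lam -> k < b.*2 ->
  (k < b -> b - k \notin lam) -> (b < k -> k - b \in lam) -> exists mu, move k lam mu b.
Proof.
move=> sl bl kb hup hdn; have ul := strict_part_uniq sl.
pose rest := [seq p <- lam | p \notin dropped k b].
have pl : perm_eq lam (dropped k b ++ rest).
  rewrite -(perm_filterC (mem (dropped k b)) lam) perm_cat2r.
  rewrite perm_sym; apply: uniq_perm; rewrite ?filter_uniq //.
    by rewrite /dropped; case: ifP => //= h; rewrite inE andbT; apply/eqP; lia.
  move=> p; rewrite mem_filter /=; apply/esym/andb_idr.
  rewrite /dropped; case: ifP => h; rewrite !inE; last by move/eqP => ->.
  by case/orP => /eqP -> //; apply: hdn.
have l0 p : p \in lam -> p != 0 by move/(strict_part_pos sl); rewrite lt0n.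
exists (to_part (added k b ++ rest)); split=> //.
  apply: to_part_strict.
    rewrite cat_uniq filter_uniq // andbT; apply/andP; split.
      by rewrite /added; case: ifP.
    apply/hasPn => p; rewrite mem_filter => /andP[_ pl']; apply/negP.
    by rewrite /added /=; case: ifP => // h; rewrite inE => /eqP e; move: (hup h); rewrite -e pl'.
  rewrite mem_cat negb_or mem_filter; apply/andP; split.
    by rewrite /added; case: ifP => // h; rewrite inE; apply/eqP; lia.
  by apply/negP => /andP[_ /l0].
apply: (@perm_trans _ (added k b ++ dropped k b ++ rest)); first by rewrite perm_cat2l.
by rewrite perm_catCA perm_cat2l perm_sym perm_to_part.
Qed.

Lemma move_inj lam mu mu' b : move k lam mu b -> move k lam mu' b -> mu = mu'.
Proof.
case=> _ _ sm pe [_ _ sm' pe']; apply: sorted_gtn_inj; try exact: sorted_strict.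
by apply: perm_mem; rewrite -(perm_cat2l (dropped k b)) -(permPl pe).
Qed.

Definition dominates (u v : nat * cell) : bool :=
  (u.1 == v.1) && (((u.2.2 == v.2.2) && (u.2.1 < v.2.1)%R) ||
                   ((u.2.1 == v.2.1) && (u.2.2 < v.2.2)%R)).

Definition moved_cell (lam : seq nat) (b : nat) : nat * cell :=
  let h := rim lam (quotient_comp b) (quotient_content b) in
  (quotient_comp b, ((h + quotient_content b)%R, h)).

Lemma move_cell lam mu b : move k lam mu b ->
  maximal_in dominates (qcells (kquotient k lam)) (moved_cell lam b) /\
  qcells (kquotient k mu) = (qcells (kquotient k lam) `\ moved_cell lam b)%fset.
Proof.
move=> mv; have [kb sl sm _] := mv.
have cle := quotient_comp_le b; have sh := quotient_shifted b.
have [eL eR eU] := move_rim mv cle.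
have vl := rim_valid sl cle; have := rim_valid sm cle; rewrite eL eR => vm.
have eU' e : (quotient_comp b == k./2) ==> (0 <= e)%R ->
    rim mu (quotient_comp b) e = (rim lam (quotient_comp b) e - Posz (e == quotient_content b))%R.
  by move/eU; rewrite eqxx.
(* The rims before and after the move are both valid, which alone forces the
   decremented diagonal to end in a corner. *)
have [u1 u2 ur] := region_decrement vl vm sh eU'.
have [cin cr cu] := corner_maximal vl (@shifted_uncut lam _) sh u1 u2.
split; first split.
- by rewrite /moved_cell mem_qcells // cle.
- case=> j [c r]; rewrite mem_qcells // /dominates /= => /andP[jk hr].
  apply/negP => /andP[/eqP jE]; rewrite -jE in hr.
  case/orP => /andP[/eqP e lt]; first by move: (cr c lt); rewrite e hr.
  by move: (cu r lt); rewrite e hr.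
apply/fsetP => -[j [c r]]; rewrite !inE !mem_qcells //.
case: (leqP j k./2) => jk /=; last by rewrite andbF.
have [jE|jE] := eqVneq j (quotient_comp b).
  rewrite jE eL eR ur andbC; congr andb.
  by rewrite /moved_cell !xpair_eqE eqxx /= negb_and.
have -> : (j, (c, r)) != moved_cell lam b by rewrite /moved_cell xpair_eqE (negbTE jE).
have [-> -> eUj] := move_rim mv jk.
rewrite /= /region; case: (boolP ((j == k./2) ==> (r <= c)%R)) => hs; last by rewrite !andbF.
rewrite eUj ?(negbTE jE) ?subr0 //.
by apply/implyP => e; move/implyP: hs => /(_ e); rewrite subr_ge0.
Qed.

(** The component determines the residue up to exchanging [r] and [k - r], and the sign of the
    content tells these apart. Content 0 has no sign, but at level 0 the condition [k < 2 b] leaves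
    only the residue above [k / 2]. *)
Lemma quotient_key_inj b b' : 0 < b -> 0 < b' -> k < b.*2 -> k < b'.*2 ->
  quotient_comp b = quotient_comp b' -> quotient_content b = quotient_content b' -> b = b'.
Proof.
move=> b0 b0' kb kb'; have bE := residue_level b0; have bE' := residue_level b0'.
have := residue_bounds b; have := residue_bounds b'.
suff h : forall r l r' l', b = l * k + r -> b' = l' * k + r' -> 0 < r' <= k -> 0 < r <= k ->
    (if r == k then k./2 else (minn r (k - r)).-1) = (if r' == k then k./2 else (minn r' (k - r')).-1) ->
    (if (k < r.*2)%N then Posz l else - Posz l)%R = (if (k < r'.*2)%N then Posz l' else - Posz l')%R ->
    r = r' /\ l = l'.
  move=> h1 h2 h3 h4; have [e1 e2] := h _ _ _ _ bE bE' h1 h2 h3 h4.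
  by rewrite bE bE' e1 e2.
move=> r l r' l' e e' hr' hr.
have l0 : l = 0 -> k < r.*2 by move=> l0; move: e; rewrite l0; lia.
have l0' : l' = 0 -> k < r'.*2 by move=> l0'; move: e'; rewrite l0'; lia.
move=> {e e' bE bE'}.
case: (ltnP k r.*2) l0 => h1 l0; case: (ltnP k r'.*2) l0' => h2 l0' hc hl.
- split; last by lia.
  move: hc; case: (eqVneq r k) => h3; case: (eqVneq r' k) => h4; lia.
- by have : l' != 0 by [apply/eqP => /l0'; lia]; lia.
- by have : l != 0 by [apply/eqP => /l0; lia]; lia.
- split; last by lia.
  move: hc; case: (eqVneq r k) => h3; case: (eqVneq r' k) => h4; lia.
Qed.

Lemma quotient_key l i : 0 < i <= k ->
  quotient_comp (l * k + i) = (if i == k then k./2 else (minn i (k - i)).-1) /\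
  quotient_content (l * k + i) = (if (k < i.*2)%N then Posz l else - Posz l)%R.
Proof. by move=> hi; rewrite /quotient_comp /quotient_content residueE // levelE. Qed.

Lemma move_of_key lam j (e : int) l i : strict_part lam -> 0 < i <= k ->
  (if i == k then k./2 else (minn i (k - i)).-1) = j ->
  (if (k < i.*2)%N then Posz l else - Posz l)%R = e ->
  l * k + i \in lam -> (0 < l -> l.-1 * k + i \notin lam) ->
  (l = 0 -> k < i.*2 /\ (i < k -> k - i \in lam)) ->
  exists mu b, move k lam mu b /\ moved_cell lam b = (j, ((rim lam j e + e)%R, rim lam j e)).
Proof.
move=> sl hi hj he bl up dn; have [q1 q2] := quotient_key l hi.
have e1 : 0 < l -> l * k + i - k = l.-1 * k + i.
  by case: l {hj he bl up dn q1 q2} => // l _; rewrite mulSn /=; lia.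
have kl : 0 < l -> k <= l * k by move=> l1; rewrite leq_pmull.
have [mu mv] : exists mu, move k lam mu (l * k + i).
  apply: move_exists => //.
  - by case: (posnP l) dn => [-> /(_ erefl)[]|/kl]; lia.
  - move=> h; have l1 : 0 < l by case: (posnP l) h => // ->; lia.
    by rewrite e1 // up.
  - move=> h; have l1 : l = 0 by case: (posnP l) => // /kl; lia.
    by move: h; rewrite l1 mul0n add0n; case: (dn l1).
by exists mu, (l * k + i); split=> //; rewrite /moved_cell q1 q2 hj he.
Qed.

(** Read on heights, the two slopes at a corner say that some level of a runner carries a bead and
    that the level below it, if any, is free. *)
Lemma cell_move lam u : strict_part lam -> maximal_in dominates (qcells (kquotient k lam)) u ->
  exists mu b, move k lam mu b /\ moved_cell lam b = u.
Proof.
case: u => j [c r] sl [uD mx]; move: (uD); rewrite mem_qcells // => /andP[jk hu].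
have n1 : ~~ region (j == k./2) (left_cut lam j) (right_cut lam j) (rim lam j) (c + 1) r.
  apply/negP => h; have /mx/negP[] : (j, ((c + 1)%R, r)) \in qcells (kquotient k lam).
    by rewrite mem_qcells // jk.
  by rewrite /dominates /= !eqxx ltrDl.
have n2 : ~~ region (j == k./2) (left_cut lam j) (right_cut lam j) (rim lam j) c (r + 1).
  apply/negP => h; have /mx/negP[] : (j, (c, (r + 1)%R)) \in qcells (kquotient k lam).
    by rewrite mem_qcells // jk.
  by rewrite /dominates /= !eqxx ltrDl orbT.
have [rE e1 se e2] := maximal_corner (rim_valid sl jk) hu n1 n2.
have -> : (j, (c, r)) = (j, ((rim lam j (c - r) + (c - r))%R, rim lam j (c - r))) :> nat * cell.
  by rewrite -rE addrC subrK.
move: (c - r)%R se e1 e2 => e se e1 e2 {rE hu uD mx n1 n2 c r}.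
have st i m : 0 < i <= k -> ht (abacus k lam i) m.+1 = ht (abacus k lam i) m.+2 + (m * k + i \in lam).
  exact: ht_abacus_step.
case: e se e1 e2 => [n|n] se e1 e2.
- have e1' : ht (right_runner lam j) n.+1 = (ht (right_runner lam j) n.+2).+1.
    move: e1; rewrite /rim /boundary (_ : (0 <= Posz n + 1)%R) ?le0z_nat; last by lia.
    rewrite (_ : `|(Posz n + 1)%R|%N = n.+1) ?absz_nat; lia.
  have e2' : 0 < n -> ht (right_runner lam j) n = ht (right_runner lam j) n.+1.
    case: n {e1 e1'} se e2 => // n se e2 _.
    have := e2 ltac:(by rewrite implybT).
    rewrite /rim /boundary le0z_nat absz_nat (_ : (Posz n.+1 - 1 = Posz n)%R); last by lia.
    by rewrite le0z_nat absz_nat; lia.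
  move: e1' e2'; rewrite /right_runner; case: ltnP => h; last first.
    have i1 : 0 < k <= k by lia.
    move=> e1' e2'; apply: (move_of_key (l := n) (i := k)) => //.
    + by rewrite eqxx; lia.
    + by rewrite ifT //; lia.
    + by have := st _ n i1; case: (_ \in _) => //; lia.
    + case: n e2' {e1 e2 se e1'} => // n e2' _.
      by have := st _ n i1; rewrite e2' //; case: (_ \in _) => //; lia.
    + by move=> _; split; lia.
  case: ifP => // h' e1' e2'.
  have i1 : 0 < k - j.+1 <= k by lia.
  apply: (move_of_key (l := n) (i := k - j.+1)) => //.
  + by rewrite ifF; lia.
  + by rewrite ifT //; lia.
  + by have := st _ n i1; case: (_ \in _) => //; lia.
  + case: n e2' {e1 e2 se e1'} => // n e2' _.
    by have := st _ n i1; rewrite e2' //; case: (_ \in _) => //; lia.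
  + move=> n0; split; first by lia.
    move=> _; rewrite n0 in e1 e2 e1'.
    have i2 : 0 < j.+1 <= k by lia.
    rewrite (_ : k - (k - j.+1) = 0 * k + j.+1); last by lia.
    (* On the central diagonal the flat step on the left belongs to the left runner, where it says
       that the lowest bead [j.+1] is present: the partner needed for a double ribbon. *)
    have := e2 ltac:(by apply/implyP => /eqP; lia).
    rewrite /rim /boundary lexx absz0 (_ : (0 <= 0 - 1 :> int)%R = false) // (_ : `|(0 - 1)%R|%N = 1) //.
    have := st _ 0 i2.
    rewrite /left_cut /right_cut /left_runner /right_runner h h'.
    by case: (_ \in lam) => //; lia.
have neg m : (0 <= Negz m)%R = false by [].
have absN m : `|Negz m|%N = m.+1 by [].
have h : j < k./2 by move: se; rewrite neg implybF; lia.
have i1 : 0 < j.+1 <= k by lia.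
have lE : left_runner lam j = abacus k lam j.+1 by rewrite /left_runner h.
have s1 := st _ n i1; have s2 := st _ n.+1 i1; rewrite -!lE in s1 s2.
(* Transposition exchanges the roles: the flat step on the left shows a bead at level [n.+1], the
   drop on the right shows that level [n] is free. *)
have f2 := e2 ltac:(by apply/implyP => /eqP; lia).
rewrite /rim /boundary (_ : (Negz n - 1 = Negz n.+1)%R) in f2; last by lia.
rewrite !neg !absN in f2.
have f1 : ht (left_runner lam j) n.+1 = ht (left_runner lam j) n.+2.
  move: e1; rewrite /rim /boundary.
  case: n {e2 s1 s2 f2 se} => [|n].
    rewrite (_ : (Negz 0 + 1 = 0)%R) // lexx absz0 neg absN /left_cut /right_cut h; lia.
  rewrite (_ : (Negz n.+1 + 1 = Negz n)%R); last by lia.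
  by rewrite !neg !absN; lia.
apply: (move_of_key (l := n.+1) (i := j.+1)) => //.
- by rewrite ifF; lia.
- by rewrite ifF; lia.
- by move: s2; case: (_ \in _) => //; lia.
- by move=> _; move: s1; case: (_ \in _) => //; lia.
Qed.

End Abacus.

(** * Tableaux and fillings *)

Definition ribbon_step (k : nat) (lam mu : seq nat) : Prop := exists b, move k lam mu b.

Lemma ribbon_step_kribbon k lam mu : strict_part lam -> strict_part mu ->
  (sdiagram mu `<=` sdiagram lam)%fset ->
  kribbon k lam (sdiagram lam `\` sdiagram mu)%fset -> ribbon_step k lam mu.
Proof.
move=> sl sm sub kr; have [h hh] := kribbon_head_exists kr.
have [ck _] := kr; have [] := kribbon_head_move sl sm sub hh.
by rewrite ck => mv _; exists `|diagv h|%N.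
Qed.

Lemma ribbon_step_removable k lam mu : 0 < k -> ribbon_step k lam mu ->
  (sdiagram mu `<` sdiagram lam)%fset /\
  removable_kribbon k lam (sdiagram lam `\` sdiagram mu)%fset.
Proof.
move=> k0 [b mv]; have [pr kr] := move_kribbon k0 mv; have [_ _ sm _] := mv.
split=> //; split=> //; split; first exact: fsubsetDl.
by exists mu; split=> //; apply: fsetDK; apply: fproper_sub.
Qed.

Lemma kcore_terminal k lam : 0 < k -> strict_part lam ->
  kcore k lam <-> terminal strict_part (ribbon_step k) lam.
Proof.
move=> k0 sl; split=> [[_ nX] mu sm st|tm].
  by apply: nX; exists (sdiagram lam `\` sdiagram mu)%fset; case: (ribbon_step_removable k0 st).
split=> // -[X [[Xl [mu [sm e]]] kr]].
have XE : X = (sdiagram lam `\` sdiagram mu)%fset by rewrite -e fsetDK.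
apply: (tm mu sm); apply: ribbon_step_kribbon; rewrite -?XE //.
by rewrite -e fsubsetDl.
Qed.

Lemma kribbon_tableau_chain k lam T : 0 < k ->
  kribbon_tableau k lam T <-> chain_to [::] strict_part (ribbon_step k) lam T.
Proof.
move=> k0; have nthT i U : all strict_part U -> i < size U -> strict_part (nth [::] U i).
  by move=> /allP aT iT; apply/aT/mem_nth.
split=> -[Tn lT aT tm st]; split=> //.
- by apply/(kcore_terminal k0); [apply: nthT => //; case: (T) Tn | exact: tm].
- move=> i /[dup] hi /andP[i0 iT]; have [/fproper_sub sub [_ kr]] := st i hi.
  by apply: ribbon_step_kribbon => //; apply: nthT => //; rewrite (leq_ltn_trans (leq_pred _)).
- by apply/(kcore_terminal k0) => //; apply: nthT => //; case: (T) Tn.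
- by move=> i hi; apply: ribbon_step_removable => //; apply: st.
Qed.

Lemma std_filling_standard_on (Q : seq component) (F : filling Q) (G : nat * cell -> nat) :
  (forall v : qcells Q, F v = G (val v)) ->
  std_filling F <-> standard_on dominates (qcells Q) G.
Proof.
move=> FG; set A := qcells Q.
have sz : size (codom F) = #|` A| by rewrite size_codom cardfE.
split=> [[pe rows cols]|[inj rg mono]].
  have inj : injective F.
    apply/injectiveP; rewrite /injectiveb /dinjectiveb -codomE.
    by rewrite (perm_uniq pe) iota_uniq.
  split.
  - move=> u v uA vA; rewrite -[u]/(val [` uA]%fset) -[v]/(val [` vA]%fset) -!FG.
    by move/inj => ->.
  - move=> u uA; rewrite -[u]/(val [` uA]%fset) -FG.
    have := codom_f F [` uA]%fset; rewrite (perm_mem pe) mem_iota add1n ltnS.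
    by case/andP => -> ->.
  - move=> u v uA vA; rewrite -[u]/(val [` uA]%fset) -[v]/(val [` vA]%fset) -!FG.
    case/andP => /eqP e /orP[] /andP[/eqP e' lt]; [exact: rows | exact: cols].
have injF : injective F.
  by move=> u v; rewrite !FG => /(inj _ _ (valP u) (valP v)) /val_inj.
split.
- apply: uniq_perm; rewrite ?iota_uniq //.
    by rewrite codomE map_inj_uniq ?enum_uniq.
  have uF : uniq (codom F) by rewrite codomE map_inj_uniq ?enum_uniq.
  have sub : {subset codom F <= iota 1 #|` A|}.
    move=> n /codomP[v ->]; rewrite mem_iota add1n ltnS FG; exact: (rg _ (valP v)).
  by have [|_ e] := uniq_min_size uF sub; first by rewrite size_iota sz.
- move=> u v e e' lt; rewrite !FG; apply: mono; try exact: valP.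
  by rewrite /dominates e e' !eqxx lt.
- move=> u v e e' lt; rewrite !FG; apply: mono; try exact: valP.
  by rewrite /dominates e e' !eqxx lt orbT.
Qed.

Section Quotient.
Variables (k : nat).
Hypothesis k0 : 0 < k.
Let D (lam : seq nat) := qcells (kquotient k lam).

Lemma ribbon_step_cell lam mu : strict_part lam -> strict_part mu -> ribbon_step k lam mu ->
  exists2 u, maximal_in dominates (D lam) u & D mu = (D lam `\ u)%fset.
Proof. by move=> _ _ [b mv]; have [mx e] := move_cell k0 mv; exists (moved_cell k lam b). Qed.

Lemma cell_ribbon_step lam u : strict_part lam -> maximal_in dominates (D lam) u ->
  exists mu, [/\ strict_part mu, ribbon_step k lam mu & D mu = (D lam `\ u)%fset].
Proof.
move=> sl mx; have [mu [b [mv <-]]] := cell_move k0 sl mx.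
by exists mu; split; [case: mv | exists b | case: (move_cell k0 mv)].
Qed.

(** Equal quotients after the step mean that the same cell was removed; its component and diagonal
    determine [b], and [b] determines the remaining parts. *)
Lemma ribbon_step_inj lam mu mu' : strict_part lam -> strict_part mu -> strict_part mu' ->
  ribbon_step k lam mu -> ribbon_step k lam mu' -> D mu = D mu' -> mu = mu'.
Proof.
move=> sl _ _ [b mv] [b' mv'].
have [[u1 _] e1] := move_cell k0 mv; have [[u2 _] e2] := move_cell k0 mv'.
rewrite /D e1 e2 => e.
have uu : moved_cell k lam b = moved_cell k lam b'.
  apply/eqP; have : moved_cell k lam b' \notin (qcells (kquotient k lam) `\ moved_cell k lam b)%fset.
    by rewrite e !inE eqxx.
  by rewrite !inE u2 andbT negbK eq_sym.
have bb : b = b'.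
  have [kb _ _ _] := mv; have [kb' _ _ _] := mv'.
  have ec := congr1 fst uu; have e4 := congr1 (fun u => diagv u.2) uu.
  apply: (quotient_key_inj k0 (move_gt0 mv) (move_gt0 mv') kb kb' ec).
  move: e4; rewrite /diagv /moved_cell /= => /addIr.
  by rewrite ![(_ + quotient_content _ _)%R]addrC !addrK.
by rewrite -bb in mv'; apply: move_inj mv mv'.
Qed.

Lemma exists_maximal_cell lam : D lam != fset0 -> exists u, maximal_in dominates (D lam) u.
Proof.
move=> /enum_fset_neq0 Dn.
(* A dominating cell has a larger sum [c + r], one coordinate being equal and the other larger. *)
have [u uD mx] := exists_argmax (fun u : nat * cell => (u.2.1 + u.2.2)%R) Dn.
exists u; split=> // v vD; apply/negP => /andP[_ h]; have := mx v vD.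
by case: u v h {uD mx vD} => j [c r] [j' [c' r']] /=; case/orP => /andP[/eqP <-]; lia.
Qed.

End Quotient.

Theorem mainTheorem1 (k : nat) (lam : seq nat) (hk : 1 <= k)
    (hlam : strict_part lam) :
  exists Phi : seq (seq nat) -> filling (kquotient k lam),
    set_bij (kribbon_tableaux k lam) (std_fillings (Q := kquotient k lam)) Phi /\
    preserves_diagonals k lam Phi.
Proof.
pose D mu := qcells (kquotient k mu).
pose A1 := @ribbon_step_cell k hk; pose A2 := @cell_ribbon_step k hk.
pose A3 := @ribbon_step_inj k hk.
have A4 mu : strict_part mu -> D mu != fset0 -> exists u, maximal_in dominates (D mu) u.
  by move=> _; apply: exists_maximal_cell.
pose Phi T : filling (kquotient k lam) := [ffun v => entry D T (val v)].
have PhiE T v : Phi T v = entry D T (val v) by rewrite ffunE.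
exists Phi; split; first split.
- move=> T /(kribbon_tableau_chain _ _ hk) cT.
  apply/(std_filling_standard_on (PhiE T)).
  exact: (chain_standard A1 A2 A4 cT).
- move=> T T' /set_mem /(kribbon_tableau_chain _ _ hk) cT
    /set_mem /(kribbon_tableau_chain _ _ hk) cT' e.
  apply: (chain_entry_inj A1 A2 A3 A4 cT cT') => u uD.
  by rewrite -[u]/(val [` uD]%fset) -!PhiE e.
- move=> F sF; pose G u := oapp F 0 (insub u : option (qcells (kquotient k lam))).
  have FG v : F v = G (val v) by rewrite /G valK.
  have /(standard_chain [::] A1 A2 A4 hlam)[T cT eT] : standard_on dominates (D lam) G.
    by move/(std_filling_standard_on FG): sF.
  exists T; first exact/(kribbon_tableau_chain _ _ hk).
  by apply/ffunP => v; rewrite PhiE FG eT //; apply: valP.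
move=> T T' /(kribbon_tableau_chain _ _ hk) cT /(kribbon_tableau_chain _ _ hk) cT' i j hi hj h h' hh hh' eh.
have cell U n g : chain_to [::] strict_part (ribbon_step k) lam U -> 0 < n < size U ->
    kribbon_head (nth [::] U n) (tab_ribbon U n) g ->
    exists2 u : qcells (kquotient k lam), Phi U u = n &
      (val u).1 = quotient_comp k `|diagv g|%N /\
      diagv (val u).2 = (quotient_content k `|diagv g|%N + 1)%R.
  move=> cU hn hg; have [_ _ aU _ st] := cU.
  have [pr [_ kr]] := ribbon_step_removable hk (st n hn).
  have [b [_ sl sm _]] := st n hn.
  have [] := kribbon_head_move sl sm (fproper_sub pr) hg; rewrite kr.1 => mv _.
  (* The cell removed by this move belongs to the quotient of shape [n] but not to that of the
     preceding shape, so its label is [n]; its component and diagonal depend only on the diagonal of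
     the head. *)
  have [[uD _] e] := move_cell hk mv.
  have [|uL ent] := chain_entry_nth A1 cU hn uD.
    by rewrite e !inE eqxx.
  exists [` uL]%fset; first by rewrite PhiE.
  split=> //=; rewrite /diagv /moved_cell /=; lia.
have [u Pu [u1 u2]] := cell _ _ _ cT hi hh.
have [v Pv [v1 v2]] := cell _ _ _ cT' hj hh'.
by exists u, v; split=> //; split; rewrite ?u1 ?u2 eh.
Qed.
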